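(* Let $\Gamma\in\mathcal L_n(z_0;z_1)$ be a locally convex curve. Let $t_\ast\in\mathrm{sing}(\Gamma)\subset(0,1)$ and $z_\ast=\Gamma(t_\ast)\in\mathrm{Sing}_{n+1}$. Then there exists an open set $\mathcal U_\ast\subset\mathrm{Spin}_{n+1}$ with $z_\ast\in\mathcal U_\ast$ and with the following properties. There exists $\epsilon>0$ such that $[t_\ast-\epsilon,t_\ast+\epsilon]\subset(0,1)$, $[t_\ast-\epsilon,t_\ast+\epsilon]\cap\mathrm{sing}(\Gamma)=\{t_\ast\}$ and $\Gamma[[t_\ast-\epsilon,t_\ast+\epsilon]]\subset\mathcal U_\ast$. There exist distinct open connected components $\mathcal U_\ast^-$ and $\mathcal U_\ast^+$ of $\mathcal U_\ast\smallsetminus\mathrm{Sing}_{n+1}$ such that $\Gamma[[t_\ast-\epsilon,t_\ast)]\subset\mathcal U_\ast^-$ and $\Gamma[(t_\ast,t_\ast+\epsilon]]\subset\mathcal U_\ast^+$.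
   Context: Fix an integer $n\ge2$. $\Pi:\mathrm{Spin}_{n+1}\to\mathrm{SO}_{n+1}$ is the universal (double) cover; Lie algebras are identified via $\Pi$. For $1\le j\le n$ let $\mathfrak a_j=e_{j+1}e_j^\top-e_je_{j+1}^\top$. A map $\Gamma:J\to\mathrm{Spin}_{n+1}$ on an interval is locally convex if it is absolutely continuous and a.e. $\Gamma^{-1}\Gamma'=\sum_j\kappa_j\mathfrak a_j$ with positive functions $\kappa_j$. For $z_0,z_1\in\mathrm{Spin}_{n+1}$, $\mathcal L_n(z_0;z_1)$ is the space of locally convex curves $\Gamma:[0,1]\to\mathrm{Spin}_{n+1}$ with $\Gamma(0)=z_0$, $\Gamma(1)=z_1$ (in any of the regularity classes $C^r$, $r\ge1$; $H^r=W^{r,2}$, $r\ge2$; or $H^1$, the latter meaning that $\kappa_j-1/\kappa_j\in L^2([0,1])$ for all $j$). Let $\eta\in S_{n+1}$, $i\mapsto n+2-i$, with permutation matrix $P_\eta$. $\mathrm{Bru}_\eta\subset\mathrm{Spin}_{n+1}$ is the open dense set of $z$ such that $\Pi(z)=U_0P_\eta U_1$ with $U_0,U_1$ invertible upper triangular; $\mathrm{Sing}_{n+1}=\mathrm{Spin}_{n+1}\smallsetminus\mathrm{Bru}_\eta$; $\mathrm{sing}(\Gamma)=\Gamma^{-1}[\mathrm{Sing}_{n+1}]\smallsetminus\{0,1\}$ for $\Gamma:[0,1]\to\mathrm{Spin}_{n+1}$ locally convex (a finite set). *)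

(* Defs.v *)
From HB Require Import structures.
From mathcomp Require Import all_boot all_order perm all_algebra.
From mathcomp Require Import all_classical all_reals all_analysis.

Set Implicit Arguments.
Unset Strict Implicit.
Unset Printing Implicit Defensive.

Import Order.TTheory GRing.Theory Num.Theory.
Import numFieldNormedType.Exports.

Local Open Scope classical_set_scope.
Local Open Scope ring_scope.

HB.mixin Record isTopologicalGroup G of Group G & Topological G := {
  mulg_continuous : continuous (fun xy : G * G => (xy.1 * xy.2)%g) ;
  invg_continuous : continuous (fun x : G => (x^-1)%g)
}.

#[short(type="topologicalGroupType")]
HB.structure Definition TopologicalGroup :=
  {G of isTopologicalGroup G & Group G & Topological G}.

(* Covering maps onto a subspace B of U.  The sheets over V `&` B are the
   members W of S; f restricts to a homeomorphism from W onto V `&` B, with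
   inverse g. *)
Definition evenly_covered (T U : topologicalType) (f : T -> U)
    (B V : set U) : Prop :=
  exists S : set (set T),
    [/\ trivIset S id,
        \bigcup_(W in S) W = f @^-1` V &
        forall W, S W ->
          [/\ open W,
              f @` W = V `&` B &
              exists g : U -> T,
                {within V `&` B, continuous g} /\ {in W, cancel f g}]].

Definition covering_map (T U : topologicalType) (f : T -> U)
    (B : set U) : Prop :=
  [/\ continuous f,
      range f = B &
      forall b, B b -> exists V : set U,
        [/\ open V, V b & evenly_covered f B V]].

Definition path_connected (R : realType) (T : topologicalType) : Prop :=
  forall x y : T, exists gamma : R -> T,
    [/\ {within `[0, 1], continuous gamma}, gamma 0 = x & gamma 1 = y].

Definition null_homotopic (R : realType) (T : topologicalType)
    (gamma : R -> T) : Prop :=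
  exists H : R * R -> T,
    [/\ {within `[0, 1] `*` `[0, 1], continuous H},
        forall s, s \in `[0, 1] -> H (s, 0) = gamma s,
        forall s, s \in `[0, 1] -> H (s, 1) = gamma 0 &
        forall t, t \in `[0, 1] -> H (0, t) = gamma 0 /\ H (1, t) = gamma 0].

Definition simply_connected (R : realType) (T : topologicalType) : Prop :=
  path_connected R T /\
  forall gamma : R -> T, {within `[0, 1], continuous gamma} ->
    gamma 0 = gamma 1 -> null_homotopic gamma.

Definition SO (R : realType) (n : nat) : set 'M[R]_n.+1 :=
  [set A | A *m A^T = 1%:M /\ \det A = 1].

(* The pair (G, Pi) is determined by this up to a unique isomorphism over
   SO_{n+1}; for 2 <= n the kernel of Pi has two elements and G is
   Spin_{n+1}. *)
Definition universal_cover (R : realType) (n : nat)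
    (G : topologicalGroupType) (Pi : G -> 'M[R]_n.+1) : Prop :=
  [/\ {morph Pi : x y / (x * y)%g >-> x *m y},
      covering_map Pi (@SO R n) &
      simply_connected R G].

Section SpinCurves.
Context {R : realType} {n : nat} {G : topologicalGroupType}.
Variable Pi : G -> 'M[R]_n.+1.

Local Notation mu := (@lebesgue_measure R).

Definition eta : 'S_n.+1 := perm (@rev_ord_inj n.+1).

(* is_trig_mx means lower triangular *)
Definition upper_invertible : set 'M[R]_n.+1 :=
  [set U | is_trig_mx U^T /\ U \in unitmx].

Definition Bru_eta : set G :=
  [set z | exists U0 U1, [/\ upper_invertible U0, upper_invertible U1 &
     Pi z = U0 *m perm_mx eta *m U1]].

Definition Sing : set G := ~` Bru_eta.

(* Indices are shifted by one: j < n stands for 1 <= j + 1 <= n. *)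
Definition fa (j : 'I_n) : 'M[R]_n.+1 :=
  delta_mx (lift ord0 j) (widen_ord (leqnSn n) j)
  - delta_mx (widen_ord (leqnSn n) j) (lift ord0 j).

Definition absolutely_continuous (a b : R) (f : R -> R) : Prop :=
  forall eps : R, 0 < eps -> exists2 delta : R, 0 < delta &
    forall (m : nat) (x y : 'I_m -> R),
      (forall i, a <= x i /\ x i <= y i /\ y i <= b) ->
      trivIset setT (fun i => `]x i, y i[%classic) ->
      \sum_i (y i - x i) < delta ->
      \sum_i `|f (y i) - f (x i)| < eps.

(* Since Pi is a local diffeomorphism, regularity of a continuous curve in G is
   regularity of its image in matrices; since the Lie algebras are identified
   via Pi, the logarithmic derivative of the curve is that of its image. *)
Definition logarithmic_derivative (Gamma : R -> G) (t : R) : 'M[R]_n.+1 :=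
  invmx (Pi (Gamma t)) *m derive1 (Pi \o Gamma) t.

Definition locally_convex_with (a b : R) (Gamma : R -> G)
    (kappa : 'I_n -> R -> R) : Prop :=
  [/\ {within `[a, b], continuous Gamma},
      forall i j, absolutely_continuous a b (fun t => Pi (Gamma t) i j),
      forall j t, t \in `[a, b] -> 0 < kappa j t &
      {ae mu, forall t, t \in `[a, b] ->
         derivable (Pi \o Gamma) t 1 /\
         logarithmic_derivative Gamma t = \sum_j kappa j t *: fa j}].

Definition locally_convex_curve (a b : R) (Gamma : R -> G) : Prop :=
  exists kappa, locally_convex_with a b Gamma kappa.

Definition L2 (f : R -> R) : Prop :=
  f \_ `[0, 1] \in Lfun mu 2%:E.

(* f is of class C^r on [0, 1], with g i the i-th derivative. *)
Definition class_C (r : nat) (f : R -> R) : Prop :=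
  exists g : nat -> R -> R,
    [/\ {in `[0, 1], g 0%N =1 f},
        forall i, (i <= r)%N -> {within `[0, 1], continuous (g i)} &
        forall i, (i < r)%N -> forall t : R, t \in `]0, 1[ ->
          is_derive t (1 : R) (g i) (g i.+1 t)].

(* f is in W^{r,2}([0, 1]), with g i the i-th weak derivative. *)
Definition class_H (r : nat) (f : R -> R) : Prop :=
  exists g : nat -> R -> R,
    [/\ {in `[0, 1], g 0%N =1 f},
        forall i, (i < r)%N -> absolutely_continuous 0 1 (g i),
        forall i, (i < r)%N -> {ae mu, forall t : R, t \in `[0, 1] ->
          is_derive t (1 : R) (g i) (g i.+1 t)} &
        L2 (g r)].

End SpinCurves.

Variant regularity : Set :=
  | RegC of nat
  | RegH of nat
  | RegH1.

Section CurveSpace.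
Context {R : realType} {n : nat} {G : topologicalGroupType}.
Variable Pi : G -> 'M[R]_n.+1.

Definition has_regularity (c : regularity) (Gamma : R -> G) : Prop :=
  match c with
  | RegC r => (1 <= r)%N /\
      forall i j, class_C r (fun t => Pi (Gamma t) i j)
  | RegH r => (2 <= r)%N /\
      forall i j, class_H r (fun t => Pi (Gamma t) i j)
  | RegH1 => exists2 kappa, locally_convex_with Pi 0 1 Gamma kappa &
      forall j, L2 (fun t => kappa j t - (kappa j t)^-1)
  end.

Definition curve_space (c : regularity) (z0 z1 : G) : set (R -> G) :=
  [set Gamma | [/\ locally_convex_curve Pi 0 1 Gamma,
                   has_regularity c Gamma, Gamma 0 = z0 & Gamma 1 = z1]].

Definition sing (Gamma : R -> G) : set R :=
  (`[0, 1] `&` Gamma @^-1` Sing Pi) `\` [set 0; 1].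

End CurveSpace.

Definition components (T : topologicalType) (A : set T) : set (set T) :=
  connected_component A @` A.

(* Main.v *)
Require Import Defs.
From mathcomp Require Import all_boot all_order all_algebra.
From mathcomp Require Import perm ring lra zify.
From mathcomp Require Import all_classical all_reals all_analysis.

Set Implicit Arguments.
Unset Strict Implicit.
Unset Printing Implicit Defensive.

Import Order.TTheory GRing.Theory Num.Theory.
Import numFieldNormedType.Exports.

(* Let z be the singular point and U (Pi z) V = P_s its Bruhat decomposition,
   V being unitriangular. Near z, factor P_s^-1 U (Pi y) V as a lower
   unitriangular matrix L(y) times an upper triangular one; L is a chart with
   L(z) = 1. List the rows of L in the order given by s, reversed, and let I_k be
   the set of its first k rows. The minors p_J of L with rows I_k and columns J,
   |J| = k, are the Plücker coordinates of a flag; y lies in Bru_eta if and only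
   if p_{1..k}(y) != 0 for all k, and p_J vanishes identically unless J <= I_k in
   the Gale order.

   (1) If all p_J are >= 0 and all p_{1..k} are nonzero, then p_J > 0 for all
   J <= I_k: by the three-term incidence relations, nonvanishing of p_J is
   inherited by smaller J. Hence the set W where p_J > 0 for all J <= I_k is both
   open and closed in the part of the chart that lies in Bru_eta, so W is a union
   of connected components.

   (2) Along a locally convex curve the derivative of L is L T with T supported on
   the first subdiagonal and positive there, so the derivative of p_J is a
   positive combination of the p_J' with J' obtained from J by replacing some j
   by j + 1. Since p_J is 0 at z except for J = I_k, after z the curve is in W,
   and before z the sign of p_J is (-1)^(sum J - sum I_k) for J <= I_k.

   (3) As z is singular, some I_k differs from {1..k}. Then {1..k} can be raised
   to some J' <= I_k with sum J' of the other parity, so the past is not in W. *)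

Local Open Scope ring_scope.

(** * Positive flags *)

Definition init (N t : nat) : {set 'I_N} := [set i : 'I_N | (i < t)%N].

Lemma card_init (N t : nat) : (t <= N)%N -> #|init N t| = t.
Proof.
move=> tN; rewrite -[RHS]card_ord.
have inj : injective (widen_ord tN) by move=> i j /(congr1 val) /= /val_inj.
rewrite -(card_imset _ inj); apply: eq_card => i; rewrite inE.
apply/idP/imsetP => [it|[j _ ->]] //=.
by exists (Ordinal it) => //; apply: val_inj.
Qed.

Section PositiveFlag.
Context {R : realDomainType} {N : nat}.
Variable p : {set 'I_N} -> R.

Hypothesis p_ge0 : forall J, 0 <= p J.
Hypothesis p_init : forall t, (t <= N)%N -> 0 < p (init N t).
Hypothesis p_plucker : forall (S : {set 'I_N}) (a b c : 'I_N),
  a \notin S -> b \notin S -> c \notin S -> (a < b)%N -> (b < c)%N ->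
  p (b |: S) * p (a |: (c |: S)) =
  p (a |: S) * p (b |: (c |: S)) + p (c |: S) * p (a |: (b |: S)).
Hypothesis p_up : forall I : {set 'I_N}, I != [set: 'I_N] -> 0 < p I ->
  exists2 x, x \notin I & 0 < p (x |: I).
Hypothesis p_down : forall (t : 'I_N) (I : {set 'I_N}), init N t \proper I -> 0 < p I ->
  exists e, [/\ e \in I, e \notin init N t & 0 < p (I :\ e)].
Hypothesis p_exchange : forall (t : 'I_N) (I : {set 'I_N}),
  init N t \proper I -> t \notin I -> 0 < p I ->
  exists y, [/\ y \in I, (t < y)%N & 0 < p (t |: (I :\ y))].

(* Proved by descending induction on t: the sets containing the first t + 1
   indices give the flag of the quotient by the first t + 1 columns. *)
Let lowering (t : nat) := forall (S : {set 'I_N}) (b c : 'I_N),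
  init N t \subset S -> b \notin S -> c \notin S -> (b < c)%N ->
  0 < p (c |: S) -> 0 < p (b |: S).

Let pgt0M (x y u v w : R) : 0 < x -> 0 < y -> u * w = x * y + v ->
  0 <= v -> 0 <= u -> 0 <= w -> 0 < u /\ 0 < w.
Proof.
move=> x0 y0 e v0 u0 w0.
have: 0 < u * w by rewrite e ltr_wpDr // mulr_gt0.
by rewrite !lt_def u0 w0 mulr_ge0 // mulf_eq0 negb_or !andbT => /andP.
Qed.

Let lowering_step (t : 'I_N) : lowering t.+1 -> lowering t.
Proof.
move=> IH.
have sub1 (S : {set 'I_N}) : init N t \subset S -> t \in S ->
    init N t.+1 \subset S.
  move=> /fintype.subsetP s tS; apply/fintype.subsetP => i; rewrite inE ltnS leq_eqVlt.
  by case/predU1P => [/val_inj ->|it] //; apply: s; rewrite inE.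
have lower (S : {set 'I_N}) b c : init N t \subset S -> b \notin t |: S ->
    c \notin t |: S -> (b < c)%N -> 0 < p (t |: (c |: S)) ->
    0 < p (t |: (b |: S)).
  move=> s bS cS bc; rewrite ![t |: (_ |: S)]finset.setUCA.
  by apply: IH => //; apply: sub1; rewrite ?setU11 // subsetU // s orbT.
have add (I : {set 'I_N}) : init N t \subset I -> t \notin I ->
    0 < p I -> 0 < p (t |: I).
  move=> s tI pI.
  have [eI|nI] := eqVneq I (init N t).
    have -> : t |: I = init N t.+1.
      by apply/setP => i; rewrite eI !inE ltnS [RHS]leq_eqVlt.
    exact: p_init.
  have ps : init N t \proper I by rewrite finset.properEneq eq_sym nI s.
  have [y [yI ty py]] := p_exchange ps tI pI.
  have [|x xI px] := p_up _ pI.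
    by apply: contra tI => /eqP ->; rewrite inE.
  have [<- //|tx] := eqVneq x t.
  have ltx : (t < x)%N.
    rewrite ltnNge; apply: contra xI => xt.
    apply: (fintype.subsetP s); rewrite inE ltn_neqAle xt andbT.
    by apply: contra tx => /eqP/val_inj ->.
  set S := I :\ y in py.
  have eI : I = y |: S by rewrite finset.setD1K.
  have tS : t \notin S by rewrite !inE (negbTE tI) andbF.
  have xS : x \notin S by rewrite !inE (negbTE xI) andbF.
  have yS : y \notin S by rewrite !inE eqxx.
  have sS : init N t \subset S.
    apply/fintype.subsetP => i it; rewrite !inE (fintype.subsetP s) // andbT.
    by apply: contraTneq it => ->; rewrite inE -leqNgt ltnW.
  have xy : x != y by apply: contraNneq xI => ->.
  rewrite eI; have [lxy|lyx|/val_inj e] := ltngtP x y; last by rewrite e eqxx in xy.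
    have := p_plucker tS xS yS ltx lxy.
    by rewrite -{2}eI => /(pgt0M py px); case=> //; apply: mulr_ge0.
  have := p_plucker tS yS xS ty lyx.
  rewrite [y |: (x |: S)]finset.setUCA -eI => /(pgt0M py px); case=> //.
    exact: mulr_ge0.
  move=> _ ptx; rewrite eI; apply: lower ptx => //.
    by rewrite in_setU1 negb_or yS andbT neq_ltn ty orbT.
  by rewrite in_setU1 negb_or xS andbT.
have base : forall m (S : {set 'I_N}) (c : 'I_N), (#|S| <= m)%N ->
    init N t \subset S -> t \notin S -> c \notin S -> (t < c)%N ->
    0 < p (c |: S) -> 0 < p (t |: S).
  elim=> [|m IHm] S c Sm s tS cS tc pc.
    have S0 : S = finset.set0 by apply/eqP; rewrite -cards_eq0 -leqn0.
    have t0 : t = 0%N :> nat.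
      have := subset_leq_card s; rewrite S0 cards0 card_init; last exact: ltnW.
      by rewrite leqn0 => /eqP.
    rewrite S0 finset.setU0 (_ : [set t] = init N 1).
      by apply: p_init; apply: leq_ltn_trans (ltn_ord t).
    by apply/setP => i; rewrite !inE ltnS leqn0 -t0.
  have ps : init N t \proper (c |: S).
    rewrite properE (fintype.subset_trans s) ?finset.subsetUr //=.
    by apply/fintype.subsetPn; exists c; rewrite ?setU11 // inE -leqNgt ltnW.
  have [e [eI et pe]] := p_down ps pc.
  have [ec|nec] := eqVneq e c.
    by apply: add => //; rewrite ec setU1K in pe.
  have eS : e \in S by move: eI; rewrite !inE (negbTE nec).
  have te : (t < e)%N.
    rewrite ltn_neqAle leqNgt; move: et; rewrite inE => ->; rewrite andbT.
    by apply: contraNneq tS => /val_inj ->.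
  set S' := S :\ e.
  have eqS : S = e |: S' by rewrite finset.setD1K.
  have eS' : e \notin S' by rewrite !inE eqxx.
  have cS' : c \notin S' by rewrite !inE (negbTE cS) andbF.
  have tS' : t \notin S' by rewrite !inE (negbTE tS) andbF.
  have sS : init N t \subset S'.
    apply/fintype.subsetP => i it; rewrite !inE (fintype.subsetP s) // andbT.
    by apply: contraTneq it => ->; rewrite inE -leqNgt ltnW.
  have eq1 : (c |: S) :\ e = c |: S'.
    apply/setP => i; rewrite !inE; case: eqVneq => //= ->.
    by rewrite (negbTE nec).
  rewrite eq1 in pe.
  have pt : 0 < p (t |: S').
    apply: (IHm S' c) => //.
    by rewrite -ltnS; apply: leq_trans Sm; rewrite (cardsD1 e S) eS.
  rewrite eqS in pc *.
  have [lce|lec|/val_inj e'] := ltngtP c e; last by rewrite e' eqxx in nec.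
    have := p_plucker tS' cS' eS' tc lce.
    by case/(pgt0M pt pc) => //; apply: mulr_ge0.
  have := p_plucker tS' eS' cS' te lec.
  rewrite [e |: (c |: S')]finset.setUCA; case/(pgt0M pt pc) => // [|_ ptc].
    exact: mulr_ge0.
  apply: lower ptc => //.
    by rewrite in_setU1 negb_or eS' andbT neq_ltn te orbT.
  by rewrite in_setU1 negb_or cS' andbT neq_ltn tc orbT.
move=> S b c s bS cS bc pc.
have [tS|tS] := boolP (t \in S); first by apply: IH pc => //; apply: sub1.
have ltb : (t <= b)%N.
  by rewrite leqNgt; apply: contra bS => bt; apply: (fintype.subsetP s); rewrite inE.
have [eb|nb] := eqVneq b t.
  by rewrite eb; apply: (base #|S| S c) => //; rewrite -?eb.
have tb : (t < b)%N.
  by rewrite ltn_neqAle ltb andbT eq_sym; apply: contra nb => /eqP/val_inj ->.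
have tc := ltn_trans tb bc.
have ptc : 0 < p (t |: (c |: S)).
  apply: add pc; first by rewrite (fintype.subset_trans s) ?finset.subsetUr.
  by rewrite in_setU1 negb_or tS andbT neq_ltn tc.
have ptb : 0 < p (t |: (b |: S)).
  apply: lower ptc => //; rewrite in_setU1 negb_or ?bS ?cS andbT neq_ltn ?tb ?tc orbT //.
have := p_plucker tS bS cS tb bc; rewrite addrC.
by case/(pgt0M pc ptb) => //; apply: mulr_ge0.
Qed.

Lemma positive_lowering (S : {set 'I_N}) (b c : 'I_N) :
  b \notin S -> c \notin S -> (b < c)%N -> 0 < p (c |: S) -> 0 < p (b |: S).
Proof.
have low0 : lowering 0.
  suff H : forall m, (m <= N)%N -> lowering (N - m).
    by have := H N (leqnn N); rewrite subnn.
  elim=> [|m IHm] mN.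
    rewrite subn0 => T b' c' /fintype.subsetP s b'T.
    by case/negP: b'T; apply: s; rewrite inE.
  have tN : (N - m.+1 < N)%N by rewrite ltn_subrL /= (leq_trans _ mN).
  apply: (@lowering_step (Ordinal tN)); rewrite /= subnSK //.
  by apply: IHm; apply: ltnW.
by apply: low0; apply/fintype.subsetP => i; rewrite inE.
Qed.

End PositiveFlag.

(** * Minors *)

Section Minors.
Context {R : fieldType} {n : nat}.
Implicit Types (M : 'M[R]_n.+1) (s : seq 'I_n.+1).

Definition minor M s : R :=
  \det (\matrix_(r < size s, c < size s) M (inord r) (nth ord0 s c)).

Lemma minorE M s k (A : 'M[R]_k) : size s = k ->
  (forall r c : 'I_k, A r c = M (inord r) (nth ord0 s c)) -> minor M s = \det A.
Proof.
move=> sk; case: _ / sk A => A AE; congr (\det _).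
by apply/matrixP => r c; rewrite mxE AE.
Qed.

Lemma minor_not_uniq M s : ~~ uniq s -> minor M s = 0.
Proof.
move=> /(uniqPn ord0)[i [j [ij js e]]].
have is_ := ltn_trans ij js.
rewrite /minor -det_tr.
apply: (determinant_alternate (i1 := Ordinal is_) (i2 := Ordinal js)).
  by rewrite -val_eqE /= neq_ltn ij.
by move=> c; rewrite !mxE /= e.
Qed.

Lemma minor_rcons_linear M s : exists w : 'I_(size s).+1 -> R,
  w ord_max = minor M s /\
  forall x, minor M (rcons s x) = \sum_r w r * M (inord r) x.
Proof.
pose A x := \matrix_(r < (size s).+1, c < (size s).+1)
  M (inord r) (nth ord0 (rcons s x) c).
exists (fun r => cofactor (A ord0) r ord_max); split.
  rewrite /cofactor /= -signr_odd oddD addbb mul1r; congr (\det _).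
  apply/matrixP => r c; rewrite !mxE /= /bump !(leqNgt (size s)) !ltn_ord !add0n.
  by rewrite nth_rcons ltn_ord.
move=> x; rewrite (@minorE M _ _ (A x)) ?size_rcons//; last first.
  by move=> r c; rewrite mxE.
rewrite (expand_det_col _ ord_max); apply: eq_bigr => r _.
rewrite mxE nth_rcons ltnn eqxx mulrC; congr (_ * _).
rewrite /cofactor; congr (_ * \det _); apply/matrixP => i j.
by rewrite !mxE !nth_rcons /= /bump (leqNgt _ j) ltn_ord add0n ltn_ord.
Qed.

Lemma minor_plucker M s a b c :
  minor M (rcons s b) * minor M (s ++ [:: a; c]) =
  minor M (rcons s a) * minor M (s ++ [:: b; c]) +
  minor M (rcons s c) * minor M (s ++ [:: a; b]).
Proof.
have [w [_ wE]] := minor_rcons_linear M s.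
set m := size s in w wE.
pose t := s ++ [:: a; b; c].
pose F x := minor M (rcons s x).
pose Z := \matrix_(r < m.+3, j < m.+3)
  if (r < m.+2)%N then M (inord r) (nth ord0 t j) else F (nth ord0 t j).
have Z0 : \det Z = 0.
  apply/eqP/det0P; exists (\row_(r < m.+3)
    if (r < m.+1)%N then w (inord r) else - (r == ord_max)%:R).
    apply/eqP => /rowP/(_ ord_max)/eqP.
    by rewrite !mxE eqxx /= ltnNge leqnSn /= oppr_eq0 oner_eq0.
  apply/rowP => j; rewrite !mxE !big_ord_recr /= !mxE /=.
  rewrite ltnn ltnS leqnn ltnSn eqxx (_ : widen_ord _ _ == ord_max = false); last first.
    by rewrite -val_eqE /= ltn_eqF.
  have -> : (m.+2 < m.+1)%N = false by lia.
  have -> : (m < m.+2)%N by lia.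
  rewrite ltnn mulr0n oppr0 mul0r addr0 mulN1r /F wE; apply/eqP; rewrite subr_eq0.
  rewrite [X in X + _](eq_bigr (fun i : 'I_m => w (widen_ord (leqnSn m) i) *
    M (inord (widen_ord (leqnSn m) i)) (nth ord0 t j))) => [|i _].
    rewrite big_ord_recr /=; apply/eqP; congr (_ + w _ * _).
    by apply: val_inj; rewrite /= inordK.
  rewrite !mxE /= !ltnS (leqW (ltnW (ltn_ord i))) (ltnW (ltn_ord i)).
  congr (w _ * _); by apply: val_inj; rewrite /= inordK // ltnS ltnW.
have cof (j : 'I_m.+3) u : size u = m.+2 ->
    (forall i, (i < m.+2)%N -> nth ord0 t (bump j i) = nth ord0 u i) ->
    cofactor Z ord_max j = (-1) ^+ (m + j) * minor M u.
  move=> su uE; rewrite /cofactor /= !addSn !exprS !mulN1r opprK.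
  congr (_ * _); rewrite (minorE (A := row' ord_max (col' j Z)) su) // => r i.
  have br : bump m.+2 r = r by rewrite /bump leqNgt ltn_ord.
  by rewrite !mxE /= br ltn_ord uE.
have := Z0; rewrite (expand_det_row _ ord_max) !big_ord_recr /=.
rewrite big1 => [|i _]; last first.
  rewrite mxE /= ltnn /F minor_not_uniq ?mul0r // nth_cat ltn_ord.
  by rewrite rcons_uniq mem_nth.
have nt i : nth ord0 t (m + i) = nth ord0 [:: a; b; c] i.
  by rewrite nth_cat ltnNge leq_addr /= addKn.
have tl i : (i < m)%N -> nth ord0 t i = nth ord0 s i.
  by move=> im; rewrite nth_cat im.
have ul (u : seq 'I_n.+1) i : (i < m)%N -> nth ord0 (s ++ u) i = nth ord0 s i.
  by move=> im; rewrite nth_cat im.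
have nu (u : seq 'I_n.+1) i : nth ord0 (s ++ u) (m + i) = nth ord0 u i.
  by rewrite nth_cat ltnNge leq_addr /= addKn.
have nu1 (u : seq 'I_n.+1) : nth ord0 (s ++ u) m.+1 = nth ord0 u 1.
  by rewrite -[m.+1]addn1 nu.
have [t0 t1 t2] : [/\ nth ord0 t m = a, nth ord0 t m.+1 = b &
    nth ord0 t m.+2 = c].
  by rewrite -[m.+2]addn2 -[m.+1]addn1 -{1}[m]addn0 !nt.
rewrite add0r !mxE /= ltnn.
rewrite (cof _ (s ++ [:: b; c])) ?size_cat ?addn2 //; last first.
  move=> i im; have [im'|] := ltnP i m.
    by rewrite /= /bump leqNgt im' /= add0n tl // ul.
  move=> /subnKC mi; rewrite -mi /= /bump leq_addr add1n -addnS nt nu.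
  by move: (i - m)%N mi im => k <-; rewrite -addn2 ltn_add2l; case: k => [|[]].
rewrite (cof _ (s ++ [:: a; c])) ?size_cat ?addn2 //; last first.
  move=> i im; have [im'|] := ltnP i m.
    by rewrite /= /bump leqNgt ltnS ltnW //= add0n tl // ul.
  move=> /subnKC mi; rewrite -mi /= /bump.
  move: (i - m)%N mi im => k <-; rewrite -addn2 ltn_add2l.
  case: k => [|[]] // _; first by rewrite addn0 ltnn add0n -[m]addn0 nt nu.
  by rewrite addn1 leqnn add1n t2 nu1.
rewrite (cof _ (s ++ [:: a; b])) ?size_cat ?addn2 //; last first.
  move=> i im; have [im'|] := ltnP i m.
    by rewrite /= /bump leqNgt ltnW ?ltnS 1?ltnW //= add0n tl // ul.
  move=> /subnKC mi; rewrite -mi /= /bump.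
  move: (i - m)%N mi im => k <-; rewrite -addn2 ltn_add2l => k2.
  rewrite leqNgt -addn2 ltn_add2l k2 /= add0n nt nu.
  by case: k k2 => [|[]].
rewrite t0 t1 t2 /F.
rewrite !addnS !exprS addnn -muln2 exprM sqrr_sign mulr1 => H.
by rewrite -[LHS]add0r -H; ring.
Qed.

Lemma minor_swap M s1 a b s2 :
  minor M (s1 ++ b :: a :: s2) = - minor M (s1 ++ a :: b :: s2).
Proof.
set s := s1 ++ a :: b :: s2.
have i1s : (size s1 < size s)%N by rewrite size_cat /= addnS ltnS leq_addr.
have i2s : ((size s1).+1 < size s)%N.
  by rewrite size_cat /= !addnS !ltnS leq_addr.
pose i1 := Ordinal i1s; pose i2 := Ordinal i2s.
have i12 : i1 != i2 by rewrite -val_eqE /= ltn_eqF.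
pose A := \matrix_(r < size s, c < size s) M (inord r) (nth ord0 s c).
rewrite (minorE (A := xcol i1 i2 A)) ?size_cat //.
  by rewrite /xcol col_permE det_mulmx tpermV det_perm odd_tperm i12 mulrN1.
move=> r c; rewrite !mxE.
have [->|n1] := eqVneq c i1.
  by rewrite tpermL /= !nth_cat ltnn subnn ltnNge leqnSn /= subSnn.
have [->|n2] := eqVneq c i2.
  by rewrite tpermR /= !nth_cat ltnn subnn ltnNge leqnSn /= subSnn.
rewrite tpermD 1?eq_sym // /s !nth_cat; case: ltnP => // le1.
have: (c - size s1 != 0)%N.
  by apply: contra n1 => /eqP e; rewrite -val_eqE /= eqn_leq le1 -subn_eq0 e.
have: (c - size s1 != 1)%N.
  apply: contra n2 => /eqP e; rewrite -val_eqE /=.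
  by rewrite -(subnKC le1) e addn1.
by case: (c - _)%N => [|[|]].
Qed.

Lemma minor_move M s1 a s2 s3 :
  minor M (s1 ++ a :: s2 ++ s3) =
  (-1) ^+ size s2 * minor M (s1 ++ s2 ++ a :: s3).
Proof.
elim: s2 s1 => [|b s2 IH] s1; first by rewrite mul1r.
by rewrite /= exprS mulN1r minor_swap -cat_rcons IH cat_rcons mulNr.
Qed.

Lemma sorted_enum_ord (J : {set 'I_n.+1}) :
  sorted (fun i j : 'I_n.+1 => (i < j)%N) (enum J).
Proof.
rewrite [enum J](_ : _ = [seq i <- enum 'I_n.+1 | i \in J]); last first.
  by rewrite [enum 'I_n.+1]enumT.
apply: sorted_filter; first by move=> y x z; apply: ltn_trans.
by have := iota_ltn_sorted 0 n.+1; rewrite -val_enum_ord sorted_map.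
Qed.

Lemma enum_ord_eq (J : {set 'I_n.+1}) s :
  sorted (fun i j : 'I_n.+1 => (i < j)%N) s -> s =i J -> enum J = s.
Proof.
move=> ss sJ; apply: irr_sorted_eq (sorted_enum_ord J) ss _.
- by move=> y x z; apply: ltn_trans.
- by move=> x; apply: ltnn.
- by move=> x; rewrite mem_enum sJ.
Qed.

Lemma enum_setU1_split (S : {set 'I_n.+1}) (a : 'I_n.+1) : a \notin S ->
  exists s1 s2, [/\ enum S = s1 ++ s2, enum (a |: S) = s1 ++ a :: s2,
    size s2 = #|[set i in S | (a < i)%N]| & all (fun i : 'I_n.+1 => (i < a)%N) s1].
Proof.
move=> aS; pose lt := fun i j : 'I_n.+1 => (i < j)%N.
have tr : transitive lt by move=> y x z; apply: ltn_trans.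
have so := sorted_enum_ord.
pose s1 := [seq i : 'I_n.+1 <- enum S | (i < a)%N].
pose s2 := [seq i : 'I_n.+1 <- enum S | (a < i)%N].
have so1 : sorted lt s1 by apply: sorted_filter.
have so2 : sorted lt s2 by apply: sorted_filter.
have a1 : all (fun i : 'I_n.+1 => (i < a)%N) s1 by apply: filter_all.
have a2 : all (fun i : 'I_n.+1 => (a < i)%N) s2 by apply: filter_all.
exists s1, s2; split => //.
- apply: enum_ord_eq.
    rewrite (sorted_pairwise tr) pairwise_cat -!(sorted_pairwise tr) so1 so2.
    rewrite !andbT; apply/allrelP => x y /(allP a1) xa /(allP a2).
    exact: ltn_trans.
  move=> x; rewrite mem_cat mem_filter mem_enum mem_filter mem_enum -andb_orl -neq_ltn.
  case xS: (x \in S); rewrite ?andbF // andbT.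
  by apply: contraNneq aS => /val_inj <-.
- apply: enum_ord_eq.
    rewrite (sorted_pairwise tr) pairwise_cat /= -!(sorted_pairwise tr) so1 so2.
    rewrite a2 !andbT; apply/allrelP => x y /(allP a1) xa.
    by rewrite inE => /predU1P[->//|/(allP a2)]; apply: ltn_trans.
  move=> x; rewrite mem_cat in_cons mem_filter mem_enum mem_filter mem_enum in_setU1 orbCA.
  rewrite -andb_orl -neq_ltn; case: eqVneq => //= nx.
  by case xS: (x \in S); rewrite ?andbF // andbT.
- rewrite cardE; congr size; symmetry; apply: enum_ord_eq => // x.
  by rewrite mem_filter mem_enum inE andbC.
Qed.

Definition set_minor M (J : {set 'I_n.+1}) : R := minor M (enum J).

Definition above (S : {set 'I_n.+1}) (a : 'I_n.+1) :=
  #|[set i in S | (a < i)%N]|.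

Lemma set_minorU1 M (S : {set 'I_n.+1}) a : a \notin S ->
  set_minor M (a |: S) = (-1) ^+ above S a * minor M (rcons (enum S) a).
Proof.
move=> aS; have [s1 [s2 [e1 e2 s2S _]]] := enum_setU1_split aS.
by rewrite /set_minor e2 e1 -[s2]cats0 minor_move cats0 s2S catA cats1.
Qed.

Lemma set_minorU2 M (S : {set 'I_n.+1}) (a b : 'I_n.+1) :
  a \notin S -> b \notin S -> (a < b)%N ->
  set_minor M (a |: (b |: S)) =
  (-1) ^+ (above S a + above S b) * minor M (enum S ++ [:: a; b]).
Proof.
move=> aS bS ab.
have abS : a \notin b |: S by rewrite in_setU1 negb_or aS andbT neq_ltn ab.
rewrite set_minorU1 //.
have -> : above (b |: S) a = (above S a).+1.
  rewrite /above (_ : [set i in b |: S | _] = b |: [set i in S | (a < i)%N]).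
    by rewrite cardsU1 inE (negbTE bS).
  by apply/setP => i; rewrite !inE; case: eqVneq => // ->.
have [s1 [s2 [e1 e2 s2S _]]] := enum_setU1_split bS.
rewrite e2 e1 -cats1 -catA cat_cons minor_move -catA /= s2S.
rewrite -[[:: b]]/([::] ++ [:: b]) exprS exprD.
rewrite (_ : s1 ++ s2 ++ [:: b; a] = (s1 ++ s2) ++ b :: [:: a]) ?catA //.
rewrite minor_swap -/(above S b); ring.
Qed.

Lemma set_minor_plucker M (S : {set 'I_n.+1}) (a b c : 'I_n.+1) :
  a \notin S -> b \notin S -> c \notin S -> (a < b)%N -> (b < c)%N ->
  set_minor M (b |: S) * set_minor M (a |: (c |: S)) =
  set_minor M (a |: S) * set_minor M (b |: (c |: S)) +
  set_minor M (c |: S) * set_minor M (a |: (b |: S)).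
Proof.
move=> aS bS cS ab bc; have ac := ltn_trans ab bc.
rewrite (set_minorU2 M aS cS ac) (set_minorU2 M bS cS bc) (set_minorU2 M aS bS ab).
rewrite !set_minorU1 //.
pose e := (-1 : R) ^+ (above S a + above S b + above S c).
pose P x y z := minor M (rcons (enum S) x) * minor M (enum S ++ [:: y; z]).
transitivity (e * P b a c); first by rewrite /e /P !exprD; ring.
rewrite /P minor_plucker /e !exprD; ring.
Qed.

Lemma set_minor_up M (I : {set 'I_n.+1}) : M \in unitmx ->
  I != [set: 'I_n.+1] -> set_minor M I != 0 ->
  exists2 x, x \notin I & set_minor M (x |: I) != 0.
Proof.
move=> uM IT MI; have [w [wm wE]] := minor_rcons_linear M (enum I).
have kN : (size (enum I) < n.+1)%N.
  rewrite -cardE -[X in (_ < X)%N]card_ord ltn_neqAle max_card andbT.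
  by apply: contra IT => /eqP e; rewrite eqEcard finset.subsetT /= cardsT e.
suff /existsP[x] : [exists x, (x \notin I) && (set_minor M (x |: I) != 0)].
  by case/andP; exists x.
apply/contraT; rewrite negb_exists => /forallP H.
pose v := \row_(i < n.+1) if (i < (size (enum I)).+1)%N then w (inord i) else 0.
have : v *m M = 0.
  apply/rowP => x; rewrite !mxE.
  transitivity (minor M (rcons (enum I) x)); first symmetry.
    rewrite wE (bigID (fun i : 'I_n.+1 => (i < (size (enum I)).+1)%N)) /=.
    rewrite [X in _ + X]big1 ?addr0 => [|i /negbTE ni]; last first.
      by rewrite mxE ni mul0r.
    pose F k := w (inord k) * M (inord k) x.
    transitivity (\sum_(i < (size (enum I)).+1) F i).
      by apply: eq_bigr => i _; rewrite /F inord_val.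
    rewrite (big_ord_widen n.+1 F) //.
    by apply: eq_bigr => i ik; rewrite mxE ik /F inord_val.
  have [xI|xI] := boolP (x \in I).
    by rewrite minor_not_uniq // rcons_uniq mem_enum xI.
  have := H x; rewrite xI /= negbK set_minorU1 // mulf_eq0 signr_eq0 /=.
  by move/eqP.
move=> /(congr1 (mulmx^~ (invmx M))); rewrite mulmxK // mul0mx.
move=> /rowP/(_ (Ordinal kN)); rewrite !mxE /= ltnSn => w0.
case/eqP: MI; rewrite /set_minor -wm -[RHS]w0; congr w; apply: val_inj.
by rewrite /= inordK.
Qed.

Lemma enum_setD1 (I : {set 'I_n.+1}) (c : nat) : (c < size (enum I))%N ->
  enum (I :\ nth ord0 (enum I) c) = take c (enum I) ++ drop c.+1 (enum I).
Proof.
move=> cI; set e := nth _ _ _.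
rewrite -{1}(index_uniq ord0 cI (enum_uniq I)) -{2}(index_uniq ord0 cI (enum_uniq I)).
rewrite -remE; apply: enum_ord_eq.
  apply: subseq_sorted (rem_subseq _ _) (sorted_enum_ord I).
  by move=> y x z; apply: ltn_trans.
by move=> x; rewrite mem_rem_uniq ?enum_uniq // !inE mem_enum.
Qed.

Lemma set_minor_down M (t : 'I_n.+1) (I : {set 'I_n.+1}) :
  (forall r c : 'I_n.+1, (c < r)%N -> M r c = 0) ->
  init n.+1 t \proper I -> set_minor M I != 0 ->
  exists e, [/\ e \in I, e \notin init n.+1 t & set_minor M (I :\ e) != 0].
Proof.
move=> Mup tI; have : (0 < size (enum I))%N.
  by rewrite -cardE (leq_ltn_trans _ (proper_card tI)).
have : (size (enum I) <= n.+1)%N by rewrite -cardE -[X in (_ <= X)%N]card_ord max_card.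
case ek : (size (enum I)) => [//|k] kn _ MI.
have [/existsP[c /andP[Vc mc]]|] := boolP [exists c : 'I_k.+1,
  (M (inord k) (nth ord0 (enum I) c) != 0) &&
  (minor M (take c (enum I) ++ drop c.+1 (enum I)) != 0)]; last first.
  rewrite negb_exists => /forallP H; case/eqP: MI.
  pose A := \matrix_(r < k.+1, c < k.+1) M (inord r) (nth ord0 (enum I) c).
  rewrite /set_minor (minorE (A := A) ek); last by move=> r c; rewrite mxE.
  rewrite (expand_det_row _ ord_max) big1 // => c _; rewrite mxE /=.
  have := H c; rewrite negb_and !negbK => /orP[/eqP ->|]; first by rewrite mul0r.
  have ck : (c < k.+1)%N := ltn_ord c.
  have sz : size (take c (enum I) ++ drop c.+1 (enum I)) = k.
    rewrite size_cat size_takel ?ek ?(ltnW ck) // size_drop ek; lia.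
  rewrite (minorE (A := row' ord_max (col' c A)) sz) => [/eqP d0|r i].
    by rewrite /cofactor d0 !mulr0.
  rewrite !mxE /= /bump (leqNgt _ r) ltn_ord add0n nth_cat size_takel ?ek ?(ltnW ck) //.
  case: ltnP => ci; first by rewrite add0n nth_take.
  rewrite add1n nth_drop; congr (M _ (nth _ _ _)).
  by rewrite addSn subnKC.
exists (nth ord0 (enum I) c); split.
- by rewrite -mem_enum mem_nth // ek ltn_ord.
- rewrite inE -leqNgt; apply: contraNT Vc; rewrite -ltnNge => lt.
  rewrite Mup // (leq_trans lt) // inordK ?ltnS //.
  by have := proper_card tI; rewrite (cardE I) ek ltnS card_init // ltnW.
- by rewrite /set_minor enum_setD1 ?ek.
Qed.

Lemma set_minor_exchange M (t : 'I_n.+1) (I : {set 'I_n.+1}) :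
  (forall r c : 'I_n.+1, (c < r)%N -> M r c = 0) -> M t t != 0 ->
  init n.+1 t \proper I -> t \notin I -> set_minor M I != 0 ->
  exists y, [/\ y \in I, (t < y)%N & set_minor M (t |: (I :\ y)) != 0].
Proof.
move=> Mup Mtt tI nt MI; set k := size (enum I).
have tk : (t < k)%N.
  by have := proper_card tI; rewrite card_init ?(ltnW (ltn_ord t)) // cardE.
pose A := \matrix_(r < k, c < k) M (inord r) (nth ord0 (enum I) c).
pose v := \col_(r < k) M (inord r) t.
have [/existsP[c /andP[Vc mc]]|] := boolP [exists c : 'I_k,
  (M t (nth ord0 (enum I) c) != 0) && ((\adj A *m v) c ord0 != 0)]; last first.
  rewrite negb_exists => /forallP H.
  have : A *m (\adj A *m v) = \det A *: v by rewrite mulmxA mul_mx_adj mul_scalar_mx.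
  move=> /colP/(_ (Ordinal tk)); rewrite !mxE big1 => [/esym/eqP|c _].
    by rewrite /= inord_val mulf_eq0 (negbTE Mtt) orbF (negbTE MI).
  rewrite mxE /= inord_val; have := H c; rewrite negb_and !negbK.
  by case/orP => /eqP ->; rewrite ?mul0r ?mulr0.
have yI : nth ord0 (enum I) c \in I by rewrite -mem_enum mem_nth.
exists (nth ord0 (enum I) c); split => //.
  rewrite ltnNge; apply: contraNN nt => yt.
  rewrite (_ : t = nth ord0 (enum I) c) //; apply/eqP.
  rewrite -val_eqE eqn_leq /= yt andbT leqNgt.
  by apply: contra Vc => /Mup ->.
rewrite set_minorU1; last by rewrite !inE negb_and nt orbT.
rewrite mulf_neq0 ?signr_eq0 // enum_setD1 //.
have := minor_move M (take c (enum I)) t (drop c.+1 (enum I)) [::].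
rewrite cats0 catA cats1 => /esym e; apply: contraNneq mc => m0.
move: e; rewrite m0 mulr0 => /esym.
pose B := \matrix_(r < k, i < k) if i == c then v r ord0 else A r i.
rewrite (minorE (A := B)) => [d0||r i].
- suff -> : (\adj A *m v) c ord0 = \det B by rewrite d0.
  rewrite mxE (expand_det_col _ c); apply: eq_bigr => r _.
  rewrite ![in LHS]mxE [in RHS]mxE eqxx mxE mulrC; congr (_ * _).
  rewrite /cofactor; congr (_ * \det _); apply/matrixP => i j.
  by rewrite !mxE eq_sym (negbTE (neq_lift _ _)).
- rewrite size_cat /= size_takel ?(ltnW (ltn_ord c)) // size_drop -/k.
  by have := ltn_ord c; lia.
rewrite !mxE -val_eqE nth_cat size_takel ?(ltnW (ltn_ord c)) //.
case: ltngtP => ic.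
- by rewrite nth_take.
- rewrite -[(i - c)%N]prednK ?subn_gt0 //= nth_drop; congr (M _ (nth _ _ _)).
  by rewrite -subnS subnKC.
- by rewrite ic subnn.
Qed.

Lemma set_minor_mulmx_lower M (X : 'M[R]_n.+1) (J : {set 'I_n.+1}) :
  (forall r c : 'I_n.+1, (r < c)%N -> X r c = 0) ->
  set_minor (X *m M) J = (\prod_(r < #|J|) X (inord r) (inord r)) * set_minor M J.
Proof.
move=> Xlow; rewrite cardE; set k := size (enum J).
have kn : (k <= n.+1)%N by rewrite /k -cardE -[X in (_ <= X)%N]card_ord max_card.
pose A := \matrix_(r < k, c < k) X (inord r) (inord c).
pose B := \matrix_(r < k, c < k) M (inord r) (nth ord0 (enum J) c).
have inK (i : 'I_k) : (inord i : 'I_n.+1) = i :> nat.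
  by rewrite inordK // (leq_trans (ltn_ord i)).
transitivity (\det (A *m B)).
  apply: minorE => // r c; rewrite !mxE.
  pose F i := X (inord r) (inord i) * M (inord i) (nth ord0 (enum J) c).
  transitivity (\sum_(i < k) F i); first by apply: eq_bigr => i _; rewrite !mxE.
  rewrite (big_ord_widen n.+1 F) // [RHS](bigID (fun i : 'I_n.+1 => (i < k)%N)) /=.
  rewrite [X in _ = _ + X]big1 ?addr0 => [|i]; last first.
    by rewrite -leqNgt => ki; rewrite Xlow ?mul0r // inK (leq_trans (ltn_ord r)).
  by apply: eq_bigr => i _; rewrite /F inord_val.
rewrite det_mulmx; congr (_ * _); rewrite det_trig.
  by apply: eq_bigr => r _; rewrite mxE.
by apply/is_trig_mxP => r c rc; rewrite mxE Xlow // !inK.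
Qed.

End Minors.

(** * Triangular matrices and the Bruhat decomposition *)

Section Triangular.
Context {R : fieldType} {n : nat}.
Implicit Types (X Z : 'M[R]_n.+1).

Definition upper X := forall r c : 'I_n.+1, (c < r)%N -> X r c = 0.
Definition lower X := forall r c : 'I_n.+1, (r < c)%N -> X r c = 0.
Definition unidiag X := forall r : 'I_n.+1, X r r = 1.

Lemma is_trig_lower X : is_trig_mx X <-> lower X.
Proof. by split=> [/is_trig_mxP|H]; last apply/is_trig_mxP. Qed.

Lemma is_trig_upper X : is_trig_mx X^T <-> upper X.
Proof.
split=> [/is_trig_mxP H r c cr|H]; first by have := H _ _ cr; rewrite mxE.
by apply/is_trig_mxP => r c rc; rewrite mxE H.
Qed.

Lemma lower_id : lower 1%:M.
Proof. by move=> r c rc; rewrite mxE -val_eqE ltn_eqF. Qed.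

Lemma unidiag_id : unidiag 1%:M.
Proof. by move=> r; rewrite mxE eqxx. Qed.

Lemma det_lower X : lower X -> \det X = \prod_r X r r.
Proof. by move=> /is_trig_lower; apply: det_trig. Qed.

Lemma det_upper X : upper X -> \det X = \prod_r X r r.
Proof.
move=> /is_trig_upper Xt; rewrite -det_tr det_trig //.
by apply: eq_bigr => r _; rewrite mxE.
Qed.

Lemma unit_upper X : upper X -> (X \in unitmx) = [forall r, X r r != 0].
Proof.
move=> Xu; rewrite unitmxE unitfE det_upper //.
apply/idP/forallP => [/prodf_neq0 H r|H]; first exact: H.
by apply/prodf_neq0 => r _.
Qed.

Lemma unit_lower X : lower X -> (X \in unitmx) = [forall r, X r r != 0].
Proof.
move=> Xl; rewrite unitmxE unitfE det_lower //.
apply/idP/forallP => [/prodf_neq0 H r|H]; first exact: H.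
by apply/prodf_neq0 => r _.
Qed.

Lemma unit_lower1 X : lower X -> unidiag X -> X \in unitmx.
Proof. by move=> Xl X1; rewrite unit_lower //; apply/forallP => r; rewrite X1 oner_neq0. Qed.

Lemma lower_cancel X Z (m : nat) c : lower X -> X \in unitmx ->
  (forall r : 'I_n.+1, (r < m)%N -> (X *m Z) r c = 0) ->
  forall r : 'I_n.+1, (r < m)%N -> Z r c = 0.
Proof.
move=> Xl; rewrite unit_lower // => /forallP X0 H r.
have [k] := ubnP (val r); elim: k r => // k IH r rk rm.
have := H r rm; rewrite mxE (bigD1 r) //= big1 => [/eqP|i ir].
  by rewrite addr0 mulf_eq0 (negbTE (X0 r)) => /eqP.
have [ri|] := ltnP r i; first by rewrite Xl ?mul0r.
rewrite leq_eqVlt val_eqE (negbTE ir) /= => ir'.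
rewrite (IH i) ?mulr0 //; first exact: leq_trans ir' rk.
exact: ltn_trans ir' rm.
Qed.

Lemma upper_cancel X Z (m : nat) c : upper X -> X \in unitmx ->
  (forall r : 'I_n.+1, (m <= r)%N -> (X *m Z) r c = 0) ->
  forall r : 'I_n.+1, (m <= r)%N -> Z r c = 0.
Proof.
move=> Xu; rewrite unit_upper // => /forallP X0 H r.
have [k] := ubnP (n - r); elim: k r => // k IH r rk rm.
have := H r rm; rewrite mxE (bigD1 r) //= big1 => [/eqP|i ir].
  by rewrite addr0 mulf_eq0 (negbTE (X0 r)) => /eqP.
have [ri|] := ltnP i r; first by rewrite Xu ?mul0r.
rewrite leq_eqVlt eq_sym val_eqE (negbTE ir) /= => ri.
rewrite (IH i) ?mulr0 //; last exact: leq_trans rm (ltnW ri).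
by have := ltn_ord i; lia.
Qed.

Lemma upper_mul X Z : upper X -> upper Z -> upper (X *m Z).
Proof.
move=> Xu Zu r c cr; rewrite mxE big1 // => i _.
have [ir|ri] := ltnP i r; first by rewrite Xu ?mul0r.
by rewrite Zu ?mulr0 // (leq_trans cr).
Qed.

Lemma upper_mul_diag X Z r : upper X -> upper Z ->
  (X *m Z) r r = X r r * Z r r.
Proof.
move=> Xu Zu; rewrite mxE (bigD1 r) //= big1 ?addr0 // => i ir.
have [ri|] := ltnP r i; first by rewrite Zu ?mulr0.
by rewrite leq_eqVlt val_eqE (negbTE ir) /= => /Xu ->; rewrite mul0r.
Qed.

Lemma upper_inv X : upper X -> X \in unitmx -> upper (invmx X).
Proof.
move=> Xu X0 r c cr; apply: (upper_cancel (m := c.+1) Xu X0) cr => i ci.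
by rewrite mulmxV // mxE -val_eqE gtn_eqF.
Qed.

Definition lead X (k : nat) : 'M[R]_n.+1 :=
  \matrix_(r, c) if (r < k)%N && (c < k)%N then X r c else (r == c)%:R.

(* The entries are those of [invmx (lead X c.+1)], written without the
   invertibility test of [invmx] so that they are rational functions of X. *)
Definition lu_upper X : 'M[R]_n.+1 :=
  \matrix_(r, c) ((\det (lead X c.+1))^-1 * (\adj (lead X c.+1)) r c).

Lemma lead_id k : lead 1%:M k = 1%:M.
Proof. by apply/matrixP => r c; rewrite !mxE; case: ifP. Qed.

Lemma lu_upper_id : lu_upper 1%:M = 1%:M.
Proof. by apply/matrixP => r c; rewrite mxE lead_id det1 invr1 mul1r adj1. Qed.

Lemma lu_upperP X : (forall c : 'I_n.+1, lead X c.+1 \in unitmx) ->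
  [/\ upper (lu_upper X), lower (X *m lu_upper X), unidiag (X *m lu_upper X) &
      lu_upper X \in unitmx].
Proof.
move=> H.
have E (r c : 'I_n.+1) : (lead X c.+1 *m lu_upper X) r c = (r == c)%:R.
  rewrite -[RHS](_ : (lead X c.+1 *m invmx (lead X c.+1)) r c = _).
    rewrite [LHS]mxE [RHS]mxE; apply: eq_bigr => i _; congr (_ * _).
    by rewrite /invmx H [RHS]mxE [LHS]mxE.
  by rewrite mulmxV // mxE.
have Yu : upper (lu_upper X).
  move=> r c cr; have := E r c; rewrite -val_eqE gtn_eqF // mxE (bigD1 r) //=.
  rewrite big1 ?addr0 => [|i ir].
    by rewrite [lead _ _ _ _]mxE ltnS leqNgt cr eqxx mul1r.
  by rewrite [lead _ _ _ _]mxE ltnS leqNgt cr eq_sym (negbTE ir) mul0r.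
have LE (r c : 'I_n.+1) : (r <= c)%N -> (X *m lu_upper X) r c = (r == c)%:R.
  move=> rc; rewrite -E [LHS]mxE [RHS]mxE; apply: eq_bigr => i _.
  have [ci|ic] := ltnP c i; first by rewrite [lu_upper X _ _]Yu // !mulr0.
  by rewrite [lead _ _ _ _]mxE !ltnS rc ic.
have Ll : lower (X *m lu_upper X).
  by move=> r c rc; rewrite LE ?(ltnW rc) // -val_eqE ltn_eqF.
have L1 : unidiag (X *m lu_upper X) by move=> r; rewrite LE // eqxx.
split=> //; have := unit_lower1 Ll L1.
by rewrite unitmx_mul => /andP[].
Qed.

End Triangular.

Lemma det_pad (R : comNzRingType) (k m : nat) (g : nat -> nat -> R) :
  \det (\matrix_(r < k + m, c < k + m)
    if (r < k)%N && (c < k)%N then g r c else (r == c)%:R) =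
  \det (\matrix_(r < k, c < k) g r c).
Proof.
elim: m => [|m IH].
  rewrite addn0; congr (\det _); apply/matrixP => r c.
  by rewrite !mxE !ltn_ord.
rewrite addnS (expand_det_row _ ord_max) (bigD1 ord_max) //= big1.
  rewrite addr0 mxE /= ltnNge leq_addr eqxx mul1r -IH /cofactor -signr_odd.
  rewrite oddD addbb mul1r; congr (\det _); apply/matrixP => r c.
  by rewrite !mxE (inj_eq lift_inj) /= /bump !(leqNgt (k + m)) !ltn_ord.
move=> c nc; rewrite mxE /= ltnNge leq_addr /=.
by rewrite eq_sym (negbTE nc) mul0r.
Qed.

Section LeadingMinors.
Context {R : fieldType} {n : nat}.
Implicit Types (X : 'M[R]_n.+1).

Lemma nth_enum_init (k c : nat) : (k <= n.+1)%N -> (c < k)%N ->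
  nth ord0 (enum (init n.+1 k)) c = c :> nat.
Proof.
move=> kn ck; set s := enum _.
have ms : [seq val i | i <- s] = iota 0 k.
  apply: (irr_sorted_eq ltn_trans ltnn).
  - by rewrite sorted_map; apply: sorted_enum_ord.
  - exact: iota_ltn_sorted.
  - move=> x; rewrite mem_iota /= add0n; apply/mapP/idP => [[i]|xk].
      by rewrite mem_enum inE => ? ->.
    by exists (inord x); rewrite ?mem_enum ?inE inordK // (leq_trans xk).
have sk : size s = k by rewrite -(size_map val) ms size_iota.
by rewrite -(nth_map _ 0%N) ?sk // ms nth_iota.
Qed.

Lemma set_minor_init X k : (k <= n.+1)%N ->
  set_minor X (init n.+1 k) = \det (lead X k).
Proof.
move=> kn; pose g r c : R := X (inord r) (inord c).
have sk : size (enum (init n.+1 k)) = k by rewrite -cardE card_init.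
rewrite /set_minor (minorE (A := \matrix_(r < k, c < k) g r c)) //; last first.
  move=> r c; rewrite mxE /g; congr (X _ _); apply: val_inj => /=.
  by rewrite nth_enum_init // inordK // (leq_trans (ltn_ord c)).
rewrite -(det_pad k (n.+1 - k) g) /lead.
have -> : \matrix_(r < n.+1, c < n.+1)
    (if (r < k)%N && (c < k)%N then X r c else (r == c)%:R) =
  \matrix_(r < n.+1, c < n.+1)
    (if (r < k)%N && (c < k)%N then g r c else (r == c)%:R).
  by apply/matrixP => r c; rewrite !mxE /g !inord_val.
by rewrite subnKC.
Qed.

Lemma lu_factorP X :
  (exists Y Z, [/\ lower Y, Y \in unitmx, upper Z, Z \in unitmx & X = Y *m Z])
  <-> forall k, (k <= n.+1)%N -> set_minor X (init n.+1 k) != 0.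
Proof.
split=> [[Y [Z [Yl Y0 Zu Z0 ->]]] k kn|H].
  rewrite set_minor_mulmx_lower // mulf_neq0 //.
    by apply/prodf_neq0 => r _; move: Y0; rewrite unit_lower // => /forallP.
  rewrite set_minor_init // det_upper.
    apply/prodf_neq0 => r _; rewrite mxE; case: ifP => _.
      by move: Z0; rewrite unit_upper // => /forallP.
    by rewrite eqxx oner_neq0.
  move=> r c cr; rewrite mxE; case: ifP => _; first exact: Zu.
  by rewrite -val_eqE gtn_eqF.
have [|Yu Ll L1 Y0] := @lu_upperP _ _ X.
  by move=> c; rewrite unitmxE unitfE -set_minor_init ?H ?ltn_ord.
exists (X *m lu_upper X), (invmx (lu_upper X)); split => //.
- exact: unit_lower1.
- exact: upper_inv.
- by rewrite unitmx_inv.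
- by rewrite mulmxK.
Qed.

End LeadingMinors.

Lemma bruhat (R : fieldType) (n : nat) (A : 'M[R]_n.+1) : A \in unitmx ->
  exists U V (s : 'S_n.+1), [/\ upper U, U \in unitmx, upper V, unidiag V &
    U *m A *m V = perm_mx s].
Proof.
move=> uA; pose N := n.+1.
have step : forall k, (k <= N)%N -> exists (U V : 'M[R]_N) (pi : 'I_N -> 'I_N),
    [/\ upper U, U \in unitmx, upper V, unidiag V &
      forall j : 'I_N, (j < k)%N ->
        (forall r, (U *m A *m V) r j = (r == pi j)%:R) /\
        (forall c, (U *m A *m V) (pi j) c = (c == j)%:R)].
  elim=> [_|k IH kN].
    by exists 1%:M, 1%:M, id; split=> //; rewrite ?unitmx1 // => r; rewrite ?mxE ?eqxx // => c cr;
      rewrite mxE -val_eqE gtn_eqF.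
  have [U [V [pi [Uu U0 Vu V1 P]]]] := IH (ltnW kN).
  set B := U *m A *m V in P.
  have V0 : V \in unitmx by rewrite unit_upper //; apply/forallP => r; rewrite V1 oner_neq0.
  have B0 : B \in unitmx by rewrite !unitmx_mul U0 uA V0.
  pose K := Ordinal kN.
  have [i0 Bi0] : exists i, B i K != 0.
    apply/existsP; apply: contraT; rewrite negb_exists => /forallP B00.
    have : (invmx B *m B) K K = 0.
      rewrite mxE big1 // => i _; have := B00 i; rewrite negbK => /eqP ->.
      by rewrite mulr0.
    by rewrite mulVmx // mxE eqxx => /eqP; rewrite oner_eq0.
  pose i := [arg max_(i > i0 | B i K != 0) (i : nat)].
  have [Bi imax] : B i K != 0 /\ forall r : 'I_N, (i < r)%N -> B r K = 0.
    rewrite /i; case: arg_maxnP => //= m Bm mmax; split=> // r mr.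
    by apply/eqP; apply: contraTT mr => /mmax; rewrite -leqNgt.
  have ipi (j : 'I_N) : (j < k)%N -> (i == pi j) = false.
    move=> jk; apply: contraNF Bi => /eqP ->; have [_ ->] := P j jk.
    by rewrite -val_eqE /= gtn_eqF.
  pose a := B i K.
  pose w r := if r == i then a^-1 - 1 else if (r < i)%N then - a^-1 * B r K else 0.
  pose E : 'M[R]_N := \matrix_(r, c) ((r == c)%:R + w r * (c == i)%:R).
  have EM (X : 'M[R]_N) r c : (E *m X) r c = X r c + w r * X i c.
    rewrite mxE (eq_bigr (fun j => (r == j)%:R * X j c + w r * ((i == j)%:R * X j c))).
      rewrite big_split /= -mulr_sumr; congr (_ + _ * _).
        rewrite (bigD1 r) //= eqxx mul1r big1 ?addr0 // => j.
        by rewrite eq_sym => /negbTE ->; rewrite mul0r.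
      rewrite (bigD1 i) //= eqxx mul1r big1 ?addr0 // => j.
      by rewrite eq_sym => /negbTE ->; rewrite mul0r.
    by move=> j _; rewrite mxE (eq_sym i) mulrDl mulrA.
  have Eu : upper E.
    move=> r c cr; rewrite mxE -val_eqE gtn_eqF // add0r.
    move: cr; have [->|_] := eqVneq c i; last by rewrite mulr0.
    move=> ir; rewrite /w; have [ri|_] := eqVneq r i; first by rewrite ri ltnn in ir.
    by rewrite ltnNge (ltnW ir) mul0r.
  have Ed r : E r r = if r == i then a^-1 else 1.
    by rewrite mxE eqxx /w; case: eqVneq => _; rewrite ?mulr1 ?mulr0 ?addr0 // addrC subrK.
  have E0 : E \in unitmx.
    rewrite unit_upper //; apply/forallP => r; rewrite Ed.
    by case: ifP => _; [exact: invr_neq0 | exact: oner_neq0].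
  set B' := E *m B.
  have B'K r : B' r K = (r == i)%:R.
    rewrite /B' EM /w; case: eqVneq => [->|ri].
      by rewrite mulrBl mul1r mulVf // addrC subrK.
    case: ltnP => [_|]; first by rewrite mulrAC mulNr mulVf // mulN1r subrr.
    rewrite leq_eqVlt eq_sym val_eqE (negbTE ri) /= => /imax ->.
    by rewrite mul0r addr0.
  pose F : 'M[R]_N := \matrix_(r, c)
    ((r == c)%:R - (r == K)%:R * ((k < c)%N%:R * B' i c)).
  have FM r c : (B' *m F) r c = B' r c - (r == i)%:R * ((k < c)%N%:R * B' i c).
    rewrite mxE (eq_bigr (fun j => B' r j * (j == c)%:R -
      B' r j * (j == K)%:R * ((k < c)%N%:R * B' i c))); last first.
      by move=> j _; rewrite [F _ _]mxE mulrBr !mulrA.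
    rewrite sumrB -mulr_suml; congr (_ - _ * _).
      rewrite (bigD1 c) //= eqxx mulr1 big1 ?addr0 // => j /negbTE ->.
      by rewrite mulr0.
    rewrite (bigD1 K) //= eqxx mulr1 big1 ?addr0 ?B'K // => j /negbTE ->.
    by rewrite mulr0.
  have Fu : upper F.
    move=> r c cr; rewrite mxE -val_eqE gtn_eqF // sub0r.
    have [rK|_] := eqVneq r K; last by rewrite mul0r oppr0.
    by rewrite rK /= in cr; rewrite ltnNge (ltnW cr) mul0r mulr0 oppr0.
  have F1 : unidiag F.
    move=> r; rewrite mxE eqxx.
    have [->|_] := eqVneq r K; last by rewrite mul0r subr0.
    by rewrite /= ltnn mul0r mulr0 subr0.
  exists (E *m U), (V *m F), (fun j => if j == K then i else pi j); split.
  - exact: upper_mul.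
  - by rewrite unitmx_mul E0.
  - exact: upper_mul.
  - by move=> r; rewrite upper_mul_diag // V1 F1 mulr1.
  have -> : E *m U *m A *m (V *m F) = B' *m F by rewrite /B' /B !mulmxA.
  move=> j; rewrite ltnS leq_eqVlt -[X in _ == X]/(nat_of_ord K) val_eqE.
  have [-> _|jK /= jk] := eqVneq j K.
    split=> [r|c]; rewrite FM; first by rewrite /= ltnn mul0r mulr0 subr0 B'K.
    rewrite eqxx mul1r; have [kc|] := ltnP k c.
      by rewrite mul1r subrr -val_eqE gtn_eqF.
    rewrite mul0r subr0 leq_eqVlt -[X in _ == X]/(nat_of_ord K) val_eqE.
    case: eqVneq => [->|cK /= ck]; first by rewrite B'K eqxx.
    rewrite /B' EM; have [-> _] := P c ck.
    by rewrite ipi // mulr0 addr0.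
  have [Pc Pr] := P j jk.
  split=> [r|c].
    rewrite FM ltnNge (ltnW jk) mul0r mulr0 subr0 /B' EM !Pc ipi //.
    by rewrite mulr0 addr0.
  rewrite FM eq_sym ipi // mul0r subr0 /B' EM /w eq_sym ipi // !Pr.
  rewrite -(val_eqE K) /= gtn_eqF // mulr0; case: ifP => _.
    by rewrite mul0r addr0.
  by rewrite mul0r addr0.
have [U [V [pi [Uu U0 Vu V1 P]]]] := step N (leqnn _).
have inj : injective pi.
  move=> j j' e; have [_ Pj] := P j (ltn_ord _); have [_ Pj'] := P j' (ltn_ord _).
  have /eqP := Pj j'; rewrite e Pj' eqxx.
  by have [//|_] := eqVneq j' j; rewrite oner_eq0.
exists U, V, (perm inj)^-1%g; split => //.
apply/matrixP => r c; have [-> _] := P c (ltn_ord _).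
rewrite !mxE; congr (nat_of_bool _)%:R.
apply/eqP/eqP => [->|<-]; first by rewrite -(permE inj) permK.
by rewrite -(permE inj) permKV.
Qed.

(** * The Gale order and coordinates of flags *)

Section Gale.
Context {n : nat}.
Implicit Types (I J : {set 'I_n.+1}).

Definition below J (x : nat) := #|[set i in J | (i < x)%N]|.

(* The Gale order: the [m]-th smallest element of [J] is at most the [m]-th
   smallest element of [I]. *)
Definition gale J I := #|J| = #|I| /\ forall x, (below I x <= below J x)%N.

Definition lo (j : 'I_n) : 'I_n.+1 := widen_ord (leqnSn n) j.
Definition hi (j : 'I_n) : 'I_n.+1 := lift ord0 j.

Definition raise J (j : 'I_n) : {set 'I_n.+1} := hi j |: (J :\ lo j).

Definition weight J := (\sum_(i in J) (i : nat))%N.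

Lemma hiE (j : 'I_n) : hi j = j.+1 :> nat. Proof. by []. Qed.

Lemma hi_eq_lo (j k : 'I_n) : (hi j == lo k) = (j.+1 == k :> nat).
Proof. by []. Qed.

Lemma card_raise J j : lo j \in J -> hi j \notin J -> #|raise J j| = #|J|.
Proof.
move=> lJ hJ; rewrite cardsU1 !inE negb_and hJ orbT.
by rewrite [RHS](cardsD1 (lo j)) lJ.
Qed.

Lemma weight_raise J j : lo j \in J -> hi j \notin J ->
  weight (raise J j) = (weight J).+1.
Proof.
move=> lJ hJ; rewrite /weight big_setU1 ?inE ?negb_and ?hJ ?orbT //=.
by rewrite (big_setD1 _ lJ).
Qed.

Lemma below_raise J j x : lo j \in J -> hi j \notin J ->
  below J x = (below (raise J j) x + (x == j.+1))%N.
Proof.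
move=> lJ hJ; rewrite /below.
have nh : hi j \notin [set i in J :\ lo j | (i < x)%N].
  by rewrite !inE (negbTE hJ) andbF.
have nl : lo j \notin [set i in J :\ lo j | (i < x)%N] by rewrite !inE eqxx.
have eJ : [set i in J | (i < x)%N] =
    if (j < x)%N then lo j |: [set i in J :\ lo j | (i < x)%N]
    else [set i in J :\ lo j | (i < x)%N].
  apply/setP => i; case: ifP => jx; rewrite !inE.
    by case: eqVneq => [->|_] //; rewrite lJ.
  by case: eqVneq => [->|_] //; rewrite lJ /= jx.
have eR : [set i in raise J j | (i < x)%N] =
    if (j.+1 < x)%N then hi j |: [set i in J :\ lo j | (i < x)%N]
    else [set i in J :\ lo j | (i < x)%N].
  apply/setP => i; case: ifP => jx; rewrite !inE.
    by case: eqVneq => [->|_] //=.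
  by case: eqVneq => [->|_] //; rewrite hiE jx !andbF.
rewrite eJ eR; case: (ltngtP x j.+1) => xj.
- by rewrite addn0.
- by rewrite !cardsU1 nh nl addn0.
- by rewrite cardsU1 nl addnC.
Qed.

Lemma below_full J x : (n < x)%N -> below J x = #|J|.
Proof.
move=> nx; apply: eq_card => i; rewrite inE.
by rewrite (leq_trans (ltn_ord i) nx) andbT.
Qed.

Lemma belowS J (i : 'I_n.+1) : below J i.+1 = (below J i + (i \in J))%N.
Proof.
rewrite /below; case iJ: (i \in J).
  rewrite (_ : [set _ in J | _] = i |: [set i0 in J | (i0 < i)%N]).
    by rewrite cardsU1 !inE ltnn andbF addnC.
  apply/setP => k; rewrite !inE ltnS leq_eqVlt val_eqE.
  by case: eqVneq => [->|] //=; rewrite iJ.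
rewrite addn0; apply: eq_card => k; rewrite !inE ltnS leq_eqVlt val_eqE.
by case: eqVneq => [->|] //=; rewrite iJ.
Qed.

Lemma eq_below I J : (forall x, below J x = below I x) -> J = I.
Proof.
move=> H; apply/setP => i; have := H i.+1; rewrite !belowS H => /addnI.
by case: (i \in J); case: (i \in I).
Qed.

Lemma gale_step I J : gale J I -> J != I ->
  exists j, [/\ lo j \in J, hi j \notin J & gale (raise J j) I].
Proof.
case=> cJI leIJ nJI.
have bad i : (i <= n)%N -> ~~ (inord i \in J) && (below I i < below J i)%N ->
    exists j, [/\ lo j \in J, hi j \notin J & gale (raise J j) I].
  elim: i => [_|i IH ni] /andP[iJ lt].
    have: below J 0 = 0%N.
      by apply/eqP; rewrite cards_eq0; apply/eqP/setP => k; rewrite !inE andbF.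
    by move=> J0; rewrite J0 in lt.
  have [i'J|i'J] := boolP ((inord i : 'I_n.+1) \in J); last first.
    apply: IH; first exact: ltnW.
    have := belowS J (inord i); rewrite (negbTE i'J) addn0 inordK ?ltnS ?(ltnW ni) //.
    move=> e; rewrite -e /=; apply: leq_ltn_trans lt.
    by have := belowS I (inord i); rewrite inordK ?ltnS ?(ltnW ni) // => ->; apply: leq_addr.
  pose j := Ordinal ni.
  have lJ : lo j \in J.
    by rewrite (_ : lo j = inord i) //; apply: val_inj; rewrite /= inordK // ltnS ltnW.
  have hJ : hi j \notin J.
    by rewrite (_ : hi j = inord i.+1) //; apply: val_inj; rewrite /= inordK.
  exists j; split=> //; split; first by rewrite card_raise.
  move=> x; have := below_raise x lJ hJ; have := leIJ x.
  by case: eqP => [-> /=|_] /=; lia.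
have ex : exists x, (below I x < below J x)%N.
  suff /existsP[x] : [exists x : 'I_n.+1, (below I x < below J x)%N] by exists x.
  apply: contraT; rewrite negb_exists => /forallP H.
  case/eqP: nJI; apply: eq_below => x; have [xn|nx] := ltnP x n.+1.
    apply/eqP; rewrite eqn_leq leIJ andbT leqNgt; exact: (H (Ordinal xn)).
  by rewrite !below_full.
have ub x : (below I x < below J x)%N -> (x <= n)%N.
  by rewrite [(x <= n)%N]leqNgt; apply: contraL => nx; rewrite !below_full // cJI ltnn.
case: (ex_maxnP ex ub) => x lx xmax; apply: (bad x (ub _ lx)).
rewrite lx andbT; have xn := ub _ lx; apply: contraTN (lx) => xJ.
have := belowS J (inord x); have := belowS I (inord x).
rewrite xJ !inordK ?ltnS // => eI eJ.
have : ~~ (below I x.+1 < below J x.+1)%N.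
  by apply/negP => /xmax; rewrite ltnn.
by rewrite eI eJ addn1 -!leqNgt; case: (_ \in _); lia.
Qed.

Lemma gale_init I : gale (init n.+1 #|I|) I.
Proof.
have In : (#|I| <= n.+1)%N by rewrite -[X in (_ <= X)%N]card_ord max_card.
split; first by rewrite card_init.
move=> x; have [xn|nx] := ltnP n x; first by rewrite !below_full // card_init.
have -> : below (init n.+1 #|I|) x = minn #|I| x.
  rewrite -(@card_init n.+1 (minn #|I| x)) ?geq_min ?In //.
  by apply: eq_card => i; rewrite !inE leq_min.
rewrite leq_min; apply/andP; split.
  by apply/subset_leq_card/fintype.subsetP => i; rewrite inE => /andP[].
rewrite -[leqRHS](@card_init n.+1 x) ?(leq_trans nx) //.
by apply/subset_leq_card/fintype.subsetP => i; rewrite !inE => /andP[].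
Qed.

End Gale.

Section RowFlag.
Context {R : realFieldType} {n : nat}.
Variable s : 'S_n.+1.
Implicit Types (L M : 'M[R]_n.+1) (J : {set 'I_n.+1}).

Lemma set_minor_support M J : set_minor M J != 0 ->
  exists f : 'I_#|J| -> 'I_n.+1,
    [/\ injective f, f @: finset.setT = J & forall r : 'I_#|J|, M (inord r) (f r) != 0].
Proof.
set k := #|J|; have ek : size (enum J) = k by rewrite -cardE.
pose A := \matrix_(r < k, c < k) M (inord r) (nth ord0 (enum J) c).
rewrite /set_minor (minorE (A := A)) //; last by move=> r c; rewrite mxE.
move=> dA; have [/existsP[g /prodf_neq0 H]|] :=
    boolP [exists g : 'S_k, \prod_i A i (g i) != 0]; last first.
  rewrite negb_exists => /forallP H; case/eqP: dA.
  rewrite /determinant big1 // => g _; have := H g; rewrite negbK => /eqP ->.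
  by rewrite mulr0.
exists (fun r => nth ord0 (enum J) (g r)); split=> [r r'||r].
- move/eqP; rewrite nth_uniq ?enum_uniq ?ek // => /eqP e.
  by apply: (perm_inj (s := g)); apply: val_inj.
- apply/setP => x; apply/imsetP/idP => [[r _ ->]|xJ].
    by rewrite -mem_enum mem_nth // ek.
  have xk : (index x (enum J) < k)%N by rewrite -ek index_mem mem_enum.
  exists ((g^-1)%g (Ordinal xk)) => //.
  by rewrite permKV /= nth_index // mem_enum.
- by have := H r isT; rewrite mxE.
Qed.

Definition flag_rows (k : nat) : {set 'I_n.+1} := s @: init n.+1 k.

Lemma card_flag_rows k : (k <= n.+1)%N -> #|flag_rows k| = k.
Proof. by move=> kn; rewrite card_imset ?card_init //; apply: perm_inj. Qed.

Let row_ k (r : 'I_k) : 'I_n.+1 := s (inord r).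

Let row_inj k : (k <= n.+1)%N -> injective (@row_ k).
Proof.
move=> kn r r' /perm_inj /(congr1 val); rewrite /= !inordK ?(leq_trans (ltn_ord _)) //.
exact: val_inj.
Qed.

Let flag_rowsE k : (k <= n.+1)%N -> flag_rows k = (@row_ k) @: finset.setT.
Proof.
move=> kn; apply/setP => x; apply/imsetP/imsetP => [[i]|[r _ ->]].
  by rewrite inE => ik ->; exists (Ordinal ik) => //; rewrite /row_ inord_val.
by exists (inord r); rewrite // inE inordK // (leq_trans (ltn_ord r)).
Qed.

Let cardJ J : (#|J| <= n.+1)%N.
Proof. by rewrite -[X in (_ <= X)%N]card_ord max_card. Qed.

Let below_imset k (f : 'I_k -> 'I_n.+1) x : injective f ->
  below (f @: finset.setT) x = #|[set r | (f r < x)%N]|.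
Proof.
move=> finj; rewrite -(card_imset _ finj); apply: eq_card => i.
rewrite inE; apply/andP/imsetP => [[/imsetP[r _ ->] rx]|[r]].
  by exists r => //; rewrite inE.
by rewrite inE => rx ->; split=> //; apply/imsetP; exists r.
Qed.

Lemma set_minor_lower_gale L J : lower L ->
  set_minor (row_perm s L) J != 0 -> gale J (flag_rows #|J|).
Proof.
move=> Ll /set_minor_support[f [finj fJ Hf]].
split; first by rewrite card_flag_rows.
move=> x; rewrite -{2}fJ flag_rowsE // !below_imset //; last exact: row_inj.
apply/subset_leq_card/fintype.subsetP => r; rewrite !inE; apply: leq_ltn_trans.
have := Hf r; rewrite mxE leqNgt; apply: contra => lt.
by rewrite Ll.
Qed.

Lemma set_minor_row_perm1 J : set_minor (row_perm s 1%:M : 'M[R]_n.+1) J != 0 ->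
  J = flag_rows #|J|.
Proof.
move=> /set_minor_support[f [finj fJ Hf]].
rewrite flag_rowsE // -{1}fJ; apply: eq_imset => r.
have := Hf r; rewrite !mxE /row_; by have [->|_] := eqVneq (s (inord r)) (f r); rewrite // mulr0n eqxx.
Qed.

Lemma set_minor_flag_rows L k : (k <= n.+1)%N -> lower L -> unidiag L ->
  set_minor (row_perm s 1%:M) (flag_rows k) *
  set_minor (row_perm s L) (flag_rows k) = 1.
Proof.
move=> kn Ll L1; set J := flag_rows k; set e := nth ord0 (enum J).
have ek : size (enum J) = k by rewrite -cardE card_flag_rows.
pose X (A : 'M[R]_n.+1) := \matrix_(r < k, c < k) A (s (inord r)) (e c).
have XE A : set_minor (row_perm s A) J = \det (X A).
  by apply: minorE => // r c; rewrite !mxE.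
have eJ (c : 'I_k) : e c \in J by rewrite -mem_enum mem_nth // ek.
rewrite !XE -det_tr -det_mulmx.
have -> : (X 1%:M)^T *m X L = \matrix_(c < k, c' < k) L (e c) (e c').
  apply/matrixP => c c'; rewrite !mxE.
  have := eJ c; rewrite /J flag_rowsE // => /imsetP[r0 _ er0].
  rewrite (bigD1 r0) //= !mxE er0 eqxx mul1r big1 ?addr0 // => r rr0.
  rewrite !mxE er0 (inj_eq perm_inj) -val_eqE /= !inordK ?(leq_trans (ltn_ord _)) //.
  by rewrite val_eqE (negbTE rr0) mul0r.
rewrite det_trig; first by rewrite big1 // => r _; rewrite mxE L1.
apply/is_trig_mxP => c c' cc'; rewrite mxE Ll //.
have := sorted_enum_ord J; rewrite sorted_pairwise; last first.
  by move=> y x z; apply: ltn_trans.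
by move=> /(pairwiseP ord0); apply; rewrite ?inE ?ek.
Qed.

(* Plücker coordinates of the flag of row spaces of [row_perm s L], normalised
   to take the value 1 at [flag_rows k] when L is lower unitriangular. *)
Definition coord L J : R :=
  set_minor (row_perm s 1%:M) (flag_rows #|J|) * set_minor (row_perm s L) J.

Lemma coord_flag_rows L k : (k <= n.+1)%N -> lower L -> unidiag L ->
  coord L (flag_rows k) = 1.
Proof. by move=> kn Ll L1; rewrite /coord card_flag_rows // set_minor_flag_rows. Qed.

Lemma coord_neq0 L J : (coord L J != 0) = (set_minor (row_perm s L) J != 0).
Proof.
rewrite /coord mulf_eq0 negb_or.
have := set_minor_flag_rows (cardJ J) (@lower_id R n) (@unidiag_id R n).
by case: eqVneq => [->|//]; rewrite mul0r => /eqP; rewrite eq_sym oner_eq0.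
Qed.

Lemma coord_gale L J : lower L -> coord L J != 0 -> gale J (flag_rows #|J|).
Proof. by rewrite coord_neq0; apply: set_minor_lower_gale. Qed.

Lemma coord1 J : coord 1%:M J = (J == flag_rows #|J|)%:R.
Proof.
have [eJ|nJ] := eqVneq J (flag_rows #|J|).
  by rewrite {1}eJ coord_flag_rows ?cardJ //; [exact: lower_id | exact: unidiag_id].
apply/eqP; apply: contraNT nJ; rewrite coord_neq0.
by move/set_minor_row_perm1/eqP.
Qed.

Lemma coord_positive L : lower L -> unidiag L ->
  (forall k, (k <= n.+1)%N -> coord L (init n.+1 k) != 0) ->
  (forall J, 0 <= coord L J) ->
  forall J, gale J (flag_rows #|J|) -> 0 < coord L J.
Proof.
move=> Ll L1 Hinit H0.
set M := row_perm s L.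
have [|Y [Z [Yl Y0 Zu Z0 MYZ]]] := (lu_factorP M).2.
  by move=> k kn; rewrite -coord_neq0 Hinit.
have uM : M \in unitmx by rewrite MYZ unitmx_mul Y0.
have Zneq J : (set_minor Z J != 0) = (0 < coord L J).
  rewrite lt_def H0 andbT coord_neq0 -/M MYZ set_minor_mulmx_lower //.
  rewrite mulf_eq0 negb_or; suff -> : \prod_(r < #|J|) Y (inord r) (inord r) != 0 by [].
  by apply/prodf_neq0 => r _; move: Y0; rewrite unit_lower // => /forallP.
have low : forall (S : {set 'I_n.+1}) (b c : 'I_n.+1), b \notin S -> c \notin S -> (b < c)%N ->
    0 < coord L (c |: S) -> 0 < coord L (b |: S).
  move=> S b c; apply: positive_lowering => //.
  - by move=> t tn; rewrite lt_def H0 andbT Hinit.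
  - move=> T x y z xT yT zT xy yz.
    have xz := ltn_trans xy yz.
    have [nx [ny nz]] : x \notin y |: T /\ x \notin z |: T /\ y \notin z |: T.
      by rewrite !in_setU1 !negb_or xT yT !andbT !neq_ltn xy yz xz.
    rewrite /coord !cardsU1 xT yT zT nx ny nz.
    set e1 := set_minor (row_perm s 1%:M) _; set e2 := set_minor (row_perm s 1%:M) _.
    have := set_minor_plucker M xT yT zT xy yz; rewrite -/M => e.
    transitivity (e1 * e2 * (set_minor M (y |: T) * set_minor M (x |: (z |: T)))).
      by ring.
    by rewrite e; ring.
  - move=> I IT pI; have [|x xI mx] := set_minor_up uM IT (I := I).
      by rewrite -coord_neq0 gt_eqF.
    by exists x => //; rewrite lt_def H0 andbT coord_neq0.
  - move=> t I tI pI; have [|e [eI et me]] := set_minor_down Zu tI.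
      by rewrite Zneq.
    by exists e; rewrite -Zneq.
  - move=> t I tI nt pI; have [||y [yI ty my]] := set_minor_exchange Zu _ tI nt.
    + by move: Z0; rewrite unit_upper // => /forallP.
    + by rewrite Zneq.
    by exists y; rewrite -Zneq.
move=> J; have [m] := ubnP (n.+1 * n.+1 - weight J).
elim: m J => // m IH J Jm gJ.
have [->|nJ] := eqVneq J (flag_rows #|J|).
  by rewrite coord_flag_rows ?cardJ.
have [j [lJ hJ gJ']] := gale_step gJ nJ.
have wJ' : (weight (raise J j) <= n.+1 * n.+1)%N.
  apply: (@leq_trans (\sum_(i in raise J j) n.+1)).
    by apply: leq_sum => i _; apply: ltnW.
  by rewrite sum_nat_const leq_mul.
have := IH (raise J j); rewrite card_raise // weight_raise // in wJ' *.
move=> /(_ _ gJ') pJ'; rewrite -(finset.setD1K lJ); apply: (low _ _ (hi j)).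
- by rewrite !inE eqxx.
- by rewrite !inE negb_and hJ orbT.
- by rewrite hiE /=.
- by apply: pJ'; lia.
Qed.

Lemma minor_raise M J j : lo j \in J ->
  minor M [seq (if i == lo j then hi j else i) | i <- enum J] =
  if hi j \in J then 0 else set_minor M (raise J j).
Proof.
move=> lJ; pose f i := if i == lo j then hi j else i.
have fl : f (lo j) = hi j by rewrite /f eqxx.
have fi i : i != lo j -> f i = i by rewrite /f => /negbTE ->.
have hl : hi j != lo j := negbT (gtn_eqF (ltnSn j)).
case: ifP => hJ.
  apply: minor_not_uniq; apply/negP => fu.
  have : (size (map f (enum J)) <= size (enum (J :\ lo j)))%N.
    apply: uniq_leq_size fu _ => _ /mapP[i + ->]; rewrite !mem_enum in_setD1 -/(f i) => iJ.
    have [->|ni] := eqVneq i (lo j); first by rewrite fl hl hJ.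
    by rewrite fi // ni iJ.
  by rewrite size_map -!cardE (cardsD1 (lo j) J) lJ ltnn.
rewrite /set_minor (_ : enum (raise J j) = map f (enum J)) //; apply: enum_ord_eq.
  rewrite sorted_map; have := sorted_enum_ord J.
  apply: (sub_in_sorted (P := mem J)); last by apply/allP => i; rewrite mem_enum.
  move=> x y xJ yJ xy; rewrite /= -/(f _) -/(f _).
  have [ex|nx] := eqVneq x (lo j); last first.
    rewrite (fi x) //; have [ey|ny] := eqVneq y (lo j); last by rewrite fi.
    by rewrite ey fl hiE ltnS ltnW //; move: xy; rewrite ey.
  have jy : (j < y)%N by move: xy; rewrite ex.
  have ny : y != lo j by rewrite -val_eqE /= gtn_eqF.
  rewrite ex fl fi // ltn_neqAle [(hi j <= y)%N]jy andbT.
  by apply: contraFN hJ => /eqP/val_inj ->.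
move=> x; apply/mapP/idP => [[i + ->]|].
  rewrite mem_enum /raise in_setU1 in_setD1 -/(f i) => iJ; have [->|ni] := eqVneq i (lo j).
    by rewrite fl eqxx.
  by rewrite fi // ni iJ orbT.
rewrite !inE => /orP[/eqP->|/andP[nx xJ]].
  by exists (lo j); rewrite ?mem_enum.
by exists x; rewrite ?mem_enum ?fi.
Qed.

Lemma coord_derivative L L' (beta : 'I_n -> R) J :
  (forall r j, L' r (lo j) = beta j * L r (hi j)) ->
  (forall r, L' r ord_max = 0) ->
  set_minor (row_perm s 1%:M) (flag_rows #|J|) *
  \sum_(c < #|J|) \det (\matrix_(r < #|J|, c' < #|J|)
    if c' == c then L' (s (inord r)) (nth ord0 (enum J) c')
    else L (s (inord r)) (nth ord0 (enum J) c')) =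
  \sum_(j | (lo j \in J) && (hi j \notin J)) beta j * coord L (raise J j).
Proof.
move=> HL Hmax; set ep := set_minor _ _.
have ek : size (enum J) = #|J| by rewrite -cardE.
pose D i := \det (\matrix_(r < #|J|, c' < #|J|)
    if nth ord0 (enum J) c' == i then L' (s (inord r)) (nth ord0 (enum J) c')
    else L (s (inord r)) (nth ord0 (enum J) c')).
transitivity (ep * \sum_(i in J) D i).
  congr (_ * _); rewrite -[RHS]big_enum /= (big_nth ord0) big_mkord ek.
  apply: eq_bigr => c _; congr (\det _); apply/matrixP => r c'; rewrite !mxE.
  by rewrite nth_uniq ?enum_uniq ?ek.
rewrite big_mkcond big_ord_recr /= [X in _ + X](_ : _ = 0) ?addr0; last first.
  case: ifP => // mJ; rewrite /D.
  have mk : (index ord_max (enum J) < #|J|)%N by rewrite -ek index_mem mem_enum.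
  rewrite (expand_det_col _ (Ordinal mk)) big1 // => r _.
  by rewrite mxE /= nth_index ?mem_enum // eqxx Hmax mul0r.
rewrite mulr_sumr [RHS]big_mkcond; apply: eq_bigr => j _.
rewrite -/(lo j); case: ifP => [lJ|_]; last by rewrite mulr0.
have -> : D (lo j) = beta j * minor (row_perm s L)
    [seq (if i == lo j then hi j else i) | i <- enum J].
  have lk : (index (lo j) (enum J) < #|J|)%N by rewrite -ek index_mem mem_enum.
  set f := (fun i => _).
  pose A := \matrix_(r < #|J|, c' < #|J|)
    L (s (inord r)) (f (nth ord0 (enum J) c')).
  rewrite (minorE (A := A)) ?size_map //; last first.
    by move=> r c; rewrite !mxE (nth_map ord0) // ek.
  rewrite /D !(expand_det_col _ (Ordinal lk)) mulr_sumr; apply: eq_bigr => r _.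
  rewrite !mxE /= nth_index ?mem_enum // /f eqxx HL -mulrA; congr (_ * (_ * _)).
  rewrite /cofactor; congr (_ * \det _); apply/matrixP => i c; rewrite !mxE /f.
  case: eqVneq => // e; have := neq_lift (Ordinal lk) c; case/negP.
  have := congr1 (index^~ (enum J)) e; rewrite index_uniq ?enum_uniq ?ek //.
  by move=> e'; apply/eqP/val_inj.
rewrite minor_raise //; case: ifP => hJ; first by rewrite !mulr0.
by rewrite /coord card_raise ?hJ // -/ep; ring.
Qed.

End RowFlag.

Section BigCell.
Context {R : realFieldType} {n : nat}.
Implicit Types (A L U : 'M[R]_n.+1) (s : 'S_n.+1).

Let rho : 'S_n.+1 := perm (@rev_ord_inj n.+1).

Let rhoV : (rho^-1 = rho)%g.
Proof.
apply/permP => i; apply: (perm_inj (s := rho)).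
by rewrite permKV !permE rev_ordK.
Qed.

Let conj_rhoE U i j : (perm_mx rho *m U *m perm_mx rho) i j = U (rev_ord i) (rev_ord j).
Proof. by rewrite -{2}rhoV -col_permE -row_permE !mxE !permE. Qed.

Let perm_rhoK : perm_mx rho *m perm_mx rho = 1%:M :> 'M[R]_n.+1.
Proof. by rewrite -perm_mxM -{1}rhoV mulVg perm_mx1. Qed.

Let unit_rho : (perm_mx rho : 'M[R]_n.+1) \in unitmx.
Proof. exact: unitmx_perm. Qed.

Lemma big_cellP A U X s :
  upper U -> U \in unitmx -> upper X -> X \in unitmx ->
  let L := invmx (perm_mx s) *m (U *m A) *m X in
  (exists W0 W1, [/\ upper W0 /\ W0 \in unitmx, upper W1 /\ W1 \in unitmx &
     A = W0 *m perm_mx rho *m W1]) <->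
  forall k, (k <= n.+1)%N -> coord (rho * s)%g L (init n.+1 k) != 0.
Proof.
move=> Uu U0 Xu X0 L.
have us : (perm_mx s : 'M[R]_n.+1) \in unitmx by apply: unitmx_perm.
have ME : row_perm (rho * s)%g L = perm_mx rho *m (U *m A *m X).
  by rewrite row_permE perm_mxM /L -mulmxA -[in LHS]mulmxA mulKVmx // mulmxA.
have -> : (forall k, (k <= n.+1)%N -> coord (rho * s)%g L (init n.+1 k) != 0) <->
    (forall k, (k <= n.+1)%N -> set_minor (row_perm (rho * s)%g L) (init n.+1 k) != 0).
  by split=> H k kn; have := H k kn; rewrite coord_neq0.
rewrite -lu_factorP ME; split=> [[W0 [W1 [[W0u W00] [W1u W10] ->]]]|].
  exists (perm_mx rho *m (U *m W0) *m perm_mx rho), (W1 *m X); split.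
  - move=> i j ij; rewrite conj_rhoE upper_mul //=.
    by have := ltn_ord j; lia.
  - by rewrite !unitmx_mul unit_rho U0 W00.
  - exact: upper_mul.
  - by rewrite unitmx_mul W10.
  - by rewrite !mulmxA.
move=> [Y [Z [Yl Y0 Zu Z0 E]]].
exists (invmx U *m (perm_mx rho *m Y *m perm_mx rho)), (Z *m invmx X); split.
- split; last by rewrite !unitmx_mul unitmx_inv U0 unit_rho Y0.
  apply: upper_mul; first exact: upper_inv.
  move=> i j ij; rewrite conj_rhoE Yl //=.
  by have := ltn_ord i; lia.
- split; last by rewrite unitmx_mul unitmx_inv X0 Z0.
  by apply: upper_mul => //; apply: upper_inv.
apply: (can_inj (mulKmx U0)); rewrite !mulmxA mulmxV // mul1mx.
rewrite -(mulmxA (perm_mx rho *m Y)) perm_rhoK mulmx1 -(mulmxA _ Y Z) -E.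
by rewrite !mulmxA perm_rhoK mul1mx mulmxK.
Qed.

(* Comparing the entries below the diagonal in [U T = K U + U'], where
   [L T = L'], shows that [T] is supported on the first subdiagonal. *)
Lemma subdiagonal_derivative (Q K U U' L' : 'M[R]_n.+1) :
  let L := Q *m U in
  Q \in unitmx -> upper U -> U \in unitmx -> upper U' ->
  (forall r c : 'I_n.+1, (c.+1 < r)%N -> K r c = 0) ->
  lower L -> unidiag L -> (forall r c : 'I_n.+1, (r <= c)%N -> L' r c = 0) ->
  L' = Q *m (K *m U + U') ->
  (forall r j, L' r (lo j) =
    K (hi j) (lo j) * (U (lo j) (lo j) / U (hi j) (hi j)) * L r (hi j)) /\
  (forall r, L' r ord_max = 0).
Proof.
move=> L Q0 Uu U0 U'u Kh Ll L1 L'l L'E.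
have L0 : L \in unitmx by apply: unit_lower1.
have [T LT] : exists T, L *m T = L' by exists (invmx L *m L'); rewrite mulKVmx.
have UT : U *m T = K *m U + U'.
  by apply: (can_inj (mulKmx Q0)); rewrite mulmxA LT.
have T1 (c r : 'I_n.+1) : (r <= c)%N -> T r c = 0.
  by rewrite -ltnS; apply: (lower_cancel Ll L0) => i; rewrite ltnS LT => /L'l.
have T2 (c r : 'I_n.+1) : (c.+2 <= r)%N -> T r c = 0.
  apply: (upper_cancel Uu U0) => i ci; rewrite UT 2!mxE big1 => [|k _].
    by rewrite add0r U'u // (leq_trans _ ci).
  have [ck|kc] := ltnP c k; first by rewrite Uu ?mulr0.
  by rewrite Kh ?mul0r // (leq_trans _ ci) // ltnS.
split=> [r j|r]; last first.
  rewrite -LT mxE big1 // => k _; rewrite T1 ?mulr0 //.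
  by rewrite -ltnS.
have Tj : T (hi j) (lo j) = K (hi j) (lo j) * (U (lo j) (lo j) / U (hi j) (hi j)).
  have Uhh : U (hi j) (hi j) != 0.
    by move: U0; rewrite unit_upper // => /forallP.
  apply: (mulfI Uhh); transitivity ((U *m T) (hi j) (lo j)).
    rewrite mxE (bigD1 (hi j)) //= big1 ?addr0 // => k kh.
    have [kj|] := ltnP k (hi j); first by rewrite Uu ?mul0r.
    rewrite leq_eqVlt eq_sym val_eqE (negbTE kh) => jk.
    by rewrite T2 ?mulr0.
  rewrite UT 2!mxE [X in _ + X]U'u ?addr0 //.
  rewrite (bigD1 (lo j)) //= big1 ?addr0.
    by rewrite [RHS]mulrC -!mulrA mulVf // mulr1.
  move=> k kl; have [jk|] := ltnP (lo j) k; first by rewrite Uu ?mulr0.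
  rewrite leq_eqVlt val_eqE (negbTE kl) => kj.
  by rewrite Kh ?mul0r.
rewrite -LT mxE (bigD1 (hi j)) //= big1 ?addr0 => [|k kh].
  by rewrite Tj mulrC.
have [kj|] := leqP k (lo j); first by rewrite T1 ?mulr0.
rewrite leq_eqVlt -[X in X == _]/(nat_of_ord (hi j)) eq_sym val_eqE (negbTE kh) => jk.
by rewrite T2 ?mulr0.
Qed.

End BigCell.

Local Open Scope classical_set_scope.
Local Open Scope ring_scope.

(** * Absolutely continuous functions *)

Section Monotone.
Context {R : realType}.
Implicit Types (f : R -> R) (a b : R).
Local Notation mu := (@lebesgue_measure R).

Lemma absolutely_continuous_sub a b c d f : a <= c -> d <= b ->
  absolutely_continuous a b f -> absolutely_continuous c d f.
Proof.
move=> ac db H eps eps0; have [delta d0 Hd] := H eps eps0.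
exists delta => // m x y xy; apply: Hd => i.
have [cx [xy' yd]] := xy i.
by split; [apply: le_trans cx|split=> //; apply: le_trans db].
Qed.

Lemma cousin_segment (T : R -> R -> Prop) a b : a <= b ->
  (forall u v w, a <= u -> u <= v -> v <= w -> w <= b ->
    T u v -> T v w -> T u w) ->
  (forall t, a <= t -> t <= b -> exists2 r, 0 < r &
    forall u v, a <= u -> t - r < u -> u <= t -> t <= v -> v < t + r -> v <= b ->
      T u v) ->
  T a b.
Proof.
move=> ab Tadd Tloc.
pose A := [set x | a <= x /\ x <= b /\ T a x].
have Aa : A a.
  split=> //; split=> //; have [r r0 Hr] := Tloc a (lexx _) ab.
  by apply: Hr => //; rewrite ?ltrBlDr ltrDl.
have hsA : has_sup A by split; [exists a | exists b => x [_ []]].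
set c := sup A.
have ac : a <= c by apply: ub_le_sup => //; case: hsA.
have cb : c <= b by apply: ge_sup; [exists a | move=> x [_ []]].
have [r r0 Hr] := Tloc c ac cb.
have [x [ax [xb Tax]] cx] := sup_adherent r0 hsA.
have xc : x <= c by apply: ub_le_sup; [case: hsA | split].
have Tac : T a c.
  by apply: (Tadd a x c) => //; apply: Hr => //; rewrite ltrDl.
have [<- //|ncb] := eqVneq c b.
have lcb : c < b by rewrite lt_neqAle ncb.
pose v := Num.min b (c + r / 2).
have cv : c < v by rewrite lt_min lcb ltrDl divr_gt0.
have vb : v <= b by rewrite ge_min lexx.
have vr : v < c + r.
  by rewrite gt_min; apply/orP; right; rewrite ltrD2l ltr_pdivrMr // ltr_pMr // ltr1n.
have Av : A v.
  split; first exact: le_trans (ltW cv).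
  split=> //; apply: (Tadd a c v) => //; first exact: ltW.
  by apply: Hr => //; [rewrite ltrBlDr ltrDl | exact: ltW].
have : v <= c by apply: ub_le_sup; case: hsA.
by rewrite leNgt cv.
Qed.

Lemma derive_ge0_local f t d eps : is_derive t (1 : R) f d -> 0 <= d -> 0 < eps ->
  exists2 r, 0 < r & forall u v, t - r < u -> u <= t -> t <= v -> v < t + r ->
    - eps * (v - u) <= f v - f u.
Proof.
move=> [df fd] d0 e0.
have /cvgrPdist_le/(_ _ e0) : h^-1 *: (f (h + t) - f t) @[h --> 0^'] --> d.
  rewrite -fd; have := df; rewrite /derivable /derive.
  by under eq_fun do rewrite [_ *: 1]mulr1.
move=> /nbhs_ballP[r /= r0 Hr]; exists r => // u v ru ut tv vr.
have key h : `|h| < r -> h != 0 -> `|f (h + t) - f t - d * h| <= eps * `|h|.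
  move=> hr h0; have := Hr h; rewrite /ball /= sub0r normrN => /(_ hr h0) H.
  rewrite -ler_pdivrMr ?normr_gt0 // -normfV -normrM -normrN.
  rewrite (_ : - _ = d - h^-1 *: (f (h + t) - f t)) //.
  by rewrite [h^-1 *: _]mulrC -mulNr opprB mulrBl mulfK.
have hv : - eps * (v - t) <= f v - f t.
  have [->|nv] := eqVneq v t; first by rewrite !subrr mulr0.
  have vt0 : 0 < v - t by rewrite subr_gt0 lt_neqAle eq_sym nv.
  have := key (v - t); rewrite gtr0_norm // ltrBlDl vr gt_eqF // subrK.
  move=> /(_ isT isT); rewrite ler_norml => /andP[+ _].
  have : 0 <= d * (v - t) by rewrite mulr_ge0 // ltW.
  lra.
have hu : - eps * (t - u) <= f t - f u.
  have [->|nu] := eqVneq u t; first by rewrite !subrr mulr0.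
  have ut0 : u - t < 0 by rewrite subr_lt0 lt_neqAle nu.
  have := key (u - t); rewrite ltr0_norm // lt_eqF // subrK opprB.
  have -> : t - u < r by lra.
  move=> /(_ isT isT); rewrite ler_norml => /andP[_ +].
  have : 0 <= d * (t - u) by rewrite mulr_ge0 // subr_ge0.
  lra.
lra.
Qed.

Lemma negligible_open_cover (N : set R) (e : R) : mu.-negligible N -> 0 < e ->
  exists U, [/\ open U, N `<=` U & (mu U <= e%:E)%E].
Proof.
move=> /negligible_outer_measure N0 e0.
have [U [oU NU]] := outer_measure_open_le N e0.
by rewrite N0 add0e; exists U.
Qed.

Lemma absolutely_continuous_nondecreasing a b f : a <= b ->
  absolutely_continuous a b f ->
  {ae mu, forall t, t \in `[a, b] ->
    exists2 d, 0 <= d & is_derive t (1 : R) f d} ->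
  f a <= f b.
Proof.
move=> ab acf aef.
suff H eps : 0 < eps -> - eps * (b - a) - eps <= f b - f a.
  have ba1 : 0 < b - a + 1 by rewrite ltr_wpDl ?subr_ge0.
  rewrite -subr_ge0 -lerN2 oppr0; apply/ler_addgt0Pl => e e0; rewrite addr0.
  have := H (e / (b - a + 1)) (divr_gt0 e0 ba1).
  have : e / (b - a + 1) * (b - a) + e / (b - a + 1) = e.
    by rewrite -{2}[e / _]mulr1 -mulrDr divfK ?gt_eqF.
  lra.
move=> e0; have [delta d0 Hd] := acf eps e0.
have d2 : 0 < delta / 2 by rewrite divr_gt0.
have [W [oW NW muW]] := negligible_open_cover aef d2.
pose T u v := exists s : seq (R * R), [/\
  all (fun p => [&& u <= p.1, p.1 <= p.2 & p.2 <= v]) s,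
  pairwise (fun p q : R * R => p.2 <= q.1) s,
  ((\sum_(p <- s) (p.2 - p.1))%:E <= mu (W `&` `]u, v[))%E &
  - eps * (v - u) - \sum_(p <- s) `|f p.2 - f p.1| <= f v - f u].
have mW : measurable W by exact: measurable_realfun.open_measurable.
have mWI u v : measurable (W `&` `]u, v[) by apply: measurableI.
have : T a b.
  apply: cousin_segment => //.
    move=> u v w au uv vw wb [s [s1 s2 s3 s4]] [t [t1 t2 t3 t4]].
    exists (s ++ t); split.
    - rewrite all_cat; apply/andP; split.
        move: s1; apply: sub_all => p /and3P[up pp pv] /=; rewrite up pp /=; exact: le_trans pv vw.
      move: t1; apply: sub_all => p /and3P[vp pp pw] /=; rewrite pp pw !andbT; exact: le_trans uv vp.
    - rewrite pairwise_cat s2 t2 !andbT; apply/allrelP => p q.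
      move=> /(allP s1)/and3P[_ _ pv] /(allP t1)/and3P[vq _ _].
      exact: le_trans pv vq.
    - rewrite big_cat /= EFinD; apply: le_trans (leeD s3 t3) _.
      rewrite -(measureU mu (mWI u v) (mWI v w)); last first.
        apply/seteqP; split=> // x [[_ /=]]; rewrite in_itv /= => /andP[_ xv].
        by case=> _ /=; rewrite in_itv /= => /andP[/(lt_trans xv)]; rewrite ltxx.
      apply: (le_measure mu); rewrite ?inE.
      + by apply: measurableU; apply: mWI.
      + exact: mWI.
      move=> x [] [Wx /=]; rewrite !in_itv /= => /andP[ux xw]; split=> //=.
        by rewrite ux (lt_le_trans xw).
      by rewrite xw (le_lt_trans uv).
    - rewrite big_cat /=; lra.
  move=> t at_ tb; have [Wt|nWt] := pselect (W t).
    have /nbhs_ballP[r /= r0 rW] : nbhs t W by apply: open_nbhs_nbhs.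
    exists r => // u v au ru ut tv vr vb.
    have uvW : `]u, v[ `<=` W.
      move=> x /=; rewrite in_itv /= => /andP[ux xv]; apply: rW.
      rewrite /ball /= ltr_norml; lra.
    have uv := le_trans ut tv.
    exists [:: (u, v)]; split=> //=; rewrite ?big_seq1 /=.
    - by rewrite !lexx uv.
    - rewrite setIidr // lebesgue_measure_itv /= lte_fin.
      have [uv'|] := ltP u v; first by rewrite -EFinB.
      by move=> vu; rewrite lee_fin subr_le0.
    - have : 0 <= eps * (v - u) by rewrite mulr_ge0 ?subr_ge0 // ltW.
      by have := ler_norm (f u - f v); rewrite distrC; lra.
  have [d dge fd] : exists2 d, 0 <= d & is_derive t (1 : R) f d.
    apply: contrapT => nd; apply: nWt; apply: NW => /= H.
    by apply: nd; apply: H; rewrite in_itv /= at_.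
  have [r r0 Hr] := derive_ge0_local fd dge e0.
  exists r => // u v au ru ut tv vr vb; exists [::]; split=> //=.
    by rewrite big_nil measure_ge0.
  by rewrite big_nil subr0; apply: Hr.
move=> [s [s1 s2 s3 s4]].
suff : \sum_(p <- s) `|f p.2 - f p.1| < eps by lra.
have := Hd (size s) (fun i => (nth (a, a) s i).1) (fun i => (nth (a, a) s i).2).
rewrite !(big_nth (a, a)) !big_mkord; apply.
- move=> i; have := mem_nth (a, a) (ltn_ord i).
  by move=> /(allP s1)/and3P[].
- move=> i j _ _ [x [/=]]; rewrite !in_itv /= => /andP[x1 x2] /andP[x3 x4].
  have /(pairwiseP (a, a)) P := s2.
  have [ij|ji|/val_inj //] := ltngtP i j.
    have := P _ _ (ltn_ord i) (ltn_ord j) ij; rewrite leNgt => /negP[].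
    exact: lt_trans x3 x2.
  have := P _ _ (ltn_ord j) (ltn_ord i) ji; rewrite leNgt => /negP[].
  exact: lt_trans x1 x4.
- rewrite -lte_fin; apply: (@le_lt_trans _ _ (delta / 2)%:E).
    move: s3; rewrite (big_nth (a, a)) big_mkord => s3.
    apply: le_trans s3 _; apply: le_trans muW.
    by apply: (le_measure mu); rewrite ?inE; [exact: mWI|exact: mW|exact: subIsetl].
  by rewrite lte_fin ltr_pdivrMr // ltr_pMr // ltr1n.
Qed.

Lemma ae_imply (P Q : R -> Prop) : (forall t, P t -> Q t) ->
  {ae mu, forall t, P t} -> {ae mu, forall t, Q t}.
Proof. by move=> PQ; apply: negligibleS; apply: subsetC => t; apply: PQ. Qed.

Lemma ae_exists (P : R -> Prop) a b : a < b -> {ae mu, forall t, P t} ->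
  exists2 t, t \in `]a, b[ & P t.
Proof.
move=> ab aeP; apply: contrapT => nP.
have N : mu.-negligible (`]a, b[ : set R).
  by apply: negligibleS aeP => t tab Pt; apply: nP; exists t.
have : mu `]a, b[ = 0%E := @measure_negligible _ _ _ mu _ (measurable_itv `]a, b[) N.
rewrite lebesgue_measure_itv /= lte_fin ab -EFinB => /eqP.
by rewrite eqe subr_eq0 gt_eqF.
Qed.

Lemma absolutely_continuous_increasing a b f : a < b ->
  absolutely_continuous a b f ->
  {ae mu, forall t, t \in `[a, b] ->
    exists2 d, 0 < d & is_derive t (1 : R) f d} ->
  f a < f b.
Proof.
move=> ab acf aef.
have mono x y : a <= x -> x <= y -> y <= b -> f x <= f y.
  move=> ax xy yb; apply: absolutely_continuous_nondecreasing => //.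
    exact: absolutely_continuous_sub acf.
  apply: ae_imply aef => t Ht; rewrite in_itv /= => /andP[xt ty].
  have [|d d0 fd] := Ht; last by exists d => //; exact: ltW.
  by rewrite in_itv /= (le_trans ax) // (le_trans ty).
rewrite lt_neqAle mono ?lexx ?(ltW ab) // andbT; apply/eqP => fab.
have [t tab Ht] := ae_exists ab aef.
have [|d d0 [_ fd]] := Ht; first exact: subset_itv_oo_cc.
suff f0 : 'D_1 f t = 0 by rewrite -fd f0 ltxx in d0.
rewrite -(derive_cst (f a) t (1 : R)); apply: near_eq_derive.
have : nbhs t `]a, b[%classic.
  by apply: open_nbhs_nbhs; split; [exact: interval_open | exact: tab].
apply: filterS => x /=; rewrite in_itv /= => /andP[ax xb].
by apply/eqP; rewrite eq_le {1}fab !mono // ltW.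
Qed.

End Monotone.

Section DeterminantDerivative.
Context {R : realType}.

Lemma is_derive_prod m (f : 'I_m -> R -> R) (df : 'I_m -> R) (t : R) :
  (forall i, is_derive t (1 : R) (f i) (df i)) ->
  is_derive t (1 : R) (fun x => \prod_i f i x)
    (\sum_c \prod_i if i == c then df i else f i t).
Proof.
elim: m f df => [|m IH] f df H.
  rewrite big_ord0 (_ : (fun x => _) = cst 1); first exact: is_derive_cst.
  by apply/funext => x; rewrite big_ord0.
pose w := widen_ord (leqnSn m).
rewrite (_ : (fun x => _) = (fun x => \prod_i f (w i) x) * f ord_max); last first.
  by apply/funext => x; rewrite big_ord_recr.
have d1 := IH (fun i => f (w i)) (fun i => df (w i)) (fun i => H (w i)).
apply: is_derive_eq (is_deriveM d1 (H ord_max)) _.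
have wm i : (w i == ord_max) = false by rewrite -val_eqE /= ltn_eqF.
rewrite [RHS]big_ord_recr [LHS]addrC; congr (_ + _).
  rewrite scaler_sumr; apply: eq_bigr => c _.
  rewrite big_ord_recr /= [ord_max == _]eq_sym wm [LHS]mulrC; congr (_ * _).
rewrite big_ord_recr /= eqxx; congr (_ * _).
by apply: eq_bigr => i _; rewrite wm.
Qed.

Lemma is_derive_det m (A : R -> 'M[R]_m) (dA : 'M[R]_m) (t : R) :
  (forall i j, is_derive t (1 : R) (fun x => A x i j) (dA i j)) ->
  is_derive t (1 : R) (fun x => \det (A x))
    (\sum_c \det (\matrix_(i, j) if j == c then dA i j else A t i j)).
Proof.
move=> H; rewrite /determinant exchange_big /=.
have -> : (fun x => \sum_(s : 'S_m) (-1) ^+ s * \prod_i A x i (s i)) =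
    \sum_(s : 'S_m) (fun x => (-1) ^+ s * \prod_i A x i (s i)).
  by apply/funext => x; rewrite fct_sumE.
apply: (@big_ind2 _ _ (fun f df => is_derive t (1 : R) f df)).
- exact: is_derive_cst.
- by move=> f df g dg; apply: is_deriveD.
move=> s _; rewrite (_ : (fun x => _) =
  (-1) ^+ s \*: (fun x => \prod_i A x i (s i))) //.
apply: is_derive_eq (is_deriveZ ((-1) ^+ s) (is_derive_prod (fun i => H i (s i)))) _.
rewrite scaler_sumr [RHS](reindex_inj (@perm_inj _ s)) /=.
apply: eq_bigr => c _; congr (_ * _); apply: eq_bigr => i _.
by rewrite mxE (inj_eq (@perm_inj _ s)).
Qed.

End DeterminantDerivative.

Section AbsolutelyContinuousRing.
Context {R : realType}.
Variables a b : R.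

Definition abs_cont_bounded (f : R -> R) :=
  absolutely_continuous a b f /\ exists M, forall x, a <= x -> x <= b -> `|f x| <= M.

Lemma abs_cont_bounded_cst c : abs_cont_bounded (fun=> c).
Proof.
split; last by exists `|c|.
move=> e e0; exists 1 => // m x y _ _ _.
by rewrite big1 // => i _; rewrite subrr normr0.
Qed.

Lemma abs_cont_lipschitz (f g h : R -> R) (K : R) :
  (forall x y, a <= x -> x <= b -> a <= y -> y <= b ->
    `|h y - h x| <= K * (`|f y - f x| + `|g y - g x|)) ->
  absolutely_continuous a b f -> absolutely_continuous a b g ->
  absolutely_continuous a b h.
Proof.
move=> hK fac gac e e0.
have K1 : 0 < `|K| + 1 by rewrite ltr_wpDl.
have e2 : 0 < e / (`|K| + 1) / 2 by rewrite !divr_gt0.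
have [d1 d10 H1] := fac _ e2; have [d2 d20 H2] := gac _ e2.
exists (Num.min d1 d2); first by rewrite lt_min d10 d20.
move=> m x y xy tr; rewrite lt_min => /andP[s1 s2].
have := ltrD (H1 m x y xy tr s1) (H2 m x y xy tr s2).
rewrite -splitr -big_split /= ltr_pdivlMr // => H.
apply: le_lt_trans H; rewrite mulr_suml; apply: ler_sum => i _.
have [ax [xy' yb]] := xy i.
apply: le_trans (hK _ _ ax (le_trans xy' yb) (le_trans ax xy') yb) _.
by rewrite mulrC ler_wpM2l ?addr_ge0 // (le_trans (ler_norm _)) // lerDl.
Qed.

Lemma abs_cont_bounded_add f g : abs_cont_bounded f -> abs_cont_bounded g ->
  abs_cont_bounded (fun x => f x + g x).
Proof.
move=> [fac [M fM]] [gac [M' gM']]; split; last first.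
  exists (M + M') => x ax xb; apply: le_trans (ler_normD _ _) _.
  by apply: lerD; auto.
apply: (abs_cont_lipschitz (K := 1) _ fac gac) => x y *.
by rewrite mul1r opprD addrACA ler_normD.
Qed.

Lemma abs_cont_bounded_mul f g : abs_cont_bounded f -> abs_cont_bounded g ->
  abs_cont_bounded (fun x => f x * g x).
Proof.
move=> [fac [M fM]] [gac [M' gM']]; split; last first.
  by exists (M * M') => x ax xb; rewrite normrM ler_pM //; auto.
apply: (abs_cont_lipschitz (K := `|M| + `|M'|) _ fac gac) => x y ax xb ay yb.
have -> : f y * g y - f x * g x = f y * (g y - g x) + (f y - f x) * g x by ring.
apply: le_trans (ler_normD _ _) _; rewrite !normrM.
have := le_trans (fM y ay yb) (ler_norm M).
have := le_trans (gM' x ax xb) (ler_norm M').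
have := normr_ge0 (g y - g x); have := normr_ge0 (f y - f x).
have := normr_ge0 M; have := normr_ge0 M'.
nra.
Qed.

Lemma abs_cont_bounded_inv f c : 0 < c -> (forall x, a <= x -> x <= b -> c <= f x) ->
  abs_cont_bounded f -> abs_cont_bounded (fun x => (f x)^-1).
Proof.
move=> c0 cf [fac _]; split; last first.
  exists c^-1 => x ax xb; have fx := lt_le_trans c0 (cf x ax xb).
  by rewrite ger0_norm ?invr_ge0 ?(ltW fx) // lef_pV2 ?posrE //; apply: cf.
apply: (abs_cont_lipschitz (K := c^-1 ^+ 2) _ fac fac) => x y ax xb ay yb.
have fx := lt_le_trans c0 (cf x ax xb); have fy := lt_le_trans c0 (cf y ay yb).
have -> : (f y)^-1 - (f x)^-1 = (f x - f y) * ((f y)^-1 * (f x)^-1).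
  by field; rewrite !gt_eqF.
rewrite normrM mulrC; apply: ler_pM => //.
  have inv z : a <= z -> z <= b -> `|(f z)^-1| <= c^-1.
    move=> az zb; have fz := lt_le_trans c0 (cf z az zb).
    by rewrite ger0_norm ?invr_ge0 ?(ltW fz) // lef_pV2 ?posrE //; apply: cf.
  by rewrite normrM expr2; apply: ler_pM; rewrite ?inv.
by rewrite distrC lerDl.
Qed.

End AbsolutelyContinuousRing.

Section FunctionRing.
Context {R : comNzRingType} {T : Type}.
Variable F : (T -> R) -> Prop.
Hypothesis F_cst : forall c, F (fun=> c).
Hypothesis F_add : forall f g, F f -> F g -> F (fun x => f x + g x).
Hypothesis F_mul : forall f g, F f -> F g -> F (fun x => f x * g x).

Lemma function_ring_sum I (r : seq I) (P : pred I) (f : I -> T -> R) :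
  (forall i, P i -> F (f i)) -> F (fun x => \sum_(i <- r | P i) f i x).
Proof.
move=> H; elim: r => [|i r IH].
  by under eq_fun do rewrite big_nil.
under eq_fun do rewrite big_cons.
by case Pi: (P i) => //; apply: F_add => //; apply: H.
Qed.

Lemma function_ring_prod I (r : seq I) (P : pred I) (f : I -> T -> R) :
  (forall i, P i -> F (f i)) -> F (fun x => \prod_(i <- r | P i) f i x).
Proof.
move=> H; elim: r => [|i r IH].
  by under eq_fun do rewrite big_nil.
under eq_fun do rewrite big_cons.
by case Pi: (P i) => //; apply: F_mul => //; apply: H.
Qed.

Lemma function_ring_det m (A : T -> 'M[R]_m) :
  (forall i j, F (fun x => A x i j)) -> F (fun x => \det (A x)).
Proof.
move=> H; apply: function_ring_sum => s _; apply: F_mul; first exact: F_cst.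
by apply: function_ring_prod.
Qed.

Lemma function_ring_mulmx m p q (A : T -> 'M[R]_(m, p)) (B : T -> 'M[R]_(p, q)) :
  (forall i j, F (fun x => A x i j)) -> (forall i j, F (fun x => B x i j)) ->
  forall i j, F (fun x => (A x *m B x) i j).
Proof.
move=> HA HB i j; under eq_fun do rewrite mxE.
by apply: function_ring_sum => k _; apply: F_mul.
Qed.

Lemma function_ring_adj m (A : T -> 'M[R]_m) :
  (forall i j, F (fun x => A x i j)) ->
  forall i j, F (fun x => (\adj (A x)) i j).
Proof.
move=> H i j; under eq_fun do rewrite mxE.
apply: F_mul; first exact: F_cst.
apply: function_ring_det => k l; under eq_fun do rewrite !mxE; exact: H.
Qed.

End FunctionRing.

(** * Coordinates along a curve *)

Section CurveCoordinates.
Context {R : realType} {n : nat}.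
Local Notation mu := (@lebesgue_measure R).

(* X is then the product of a lower unitriangular matrix and of an upper
   triangular one with positive diagonal. The uniform bound 2^-1 makes the
   inverses of the determinants absolutely continuous along curves. *)
Definition lu_chart (X : 'M[R]_n.+1) :=
  forall c : 'I_n.+1, 2^-1 < \det (lead X c.+1) /\ 0 < lu_upper X c c.

Lemma lu_chart_unit X : lu_chart X -> forall c : 'I_n.+1, lead X c.+1 \in unitmx.
Proof.
move=> H c; rewrite unitmxE unitfE gt_eqF //.
by apply: lt_trans (H c).1; rewrite invr_gt0.
Qed.

Lemma is_derive_mulmx m p q (A : R -> 'M[R]_(m, p)) (B : R -> 'M[R]_(p, q))
    (dA : 'M[R]_(m, p)) (dB : 'M[R]_(p, q)) (t : R) :
  (forall i j, is_derive t (1 : R) (fun x => A x i j) (dA i j)) ->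
  (forall i j, is_derive t (1 : R) (fun x => B x i j) (dB i j)) ->
  forall i j, is_derive t (1 : R) (fun x => (A x *m B x) i j)
    ((dA *m B t + A t *m dB) i j).
Proof.
move=> HA HB i j.
rewrite (_ : (fun x => _) =
    \sum_(k < p) ((fun x => A x i k) * (fun x => B x k j))); last first.
  by apply/funext => x; rewrite mxE fct_sumE.
apply: is_derive_eq (is_derive_sum (fun k => is_deriveM (HA i k) (HB k j))) _.
rewrite !mxE -big_split /=; apply: eq_bigr => k _.
by rewrite addrC; congr (_ + _); rewrite mulrC.
Qed.

Lemma is_derive_cst_mx m p (A : 'M[R]_(m, p)) (t : R) i j :
  is_derive t (1 : R) (fun=> A i j) ((0 : 'M[R]_(m, p)) i j).
Proof. by apply: is_derive_eq (is_derive_cst _ _ _) _; rewrite mxE. Qed.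

Lemma is_derive_near_cst (f : R -> R) (c t d : R) :
  (\forall x \near t, f x = c) -> is_derive t (1 : R) f d -> d = 0.
Proof.
move=> fc [_ <-]; rewrite -(derive_cst c t (1 : R)).
exact: near_eq_derive.
Qed.

Lemma derivable_lu_upper (X : R -> 'M[R]_n.+1) (t : R) :
  (forall c : 'I_n.+1, \det (lead (X t) c.+1) != 0) ->
  (forall i j, derivable (fun x => X x i j) t 1) ->
  forall i j, derivable (fun x => lu_upper (X x) i j) t 1.
Proof.
move=> X0 dX i j.
pose F (f : R -> R) := derivable f t 1.
have Fc c : F (fun=> c) by apply: derivable_cst.
have Fa f g : F f -> F g -> F (fun x => f x + g x) by apply: derivableD.
have Fm f g : F f -> F g -> F (fun x => f x * g x) by apply: derivableM.
have Fl k i' j' : F (fun x => lead (X x) k i' j').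
  under eq_fun do rewrite mxE.
  case: (_ && _); [exact: dX | exact: Fc].
under eq_fun do rewrite mxE.
apply: (Fm).
  by apply: derivableV => //; apply: (function_ring_det Fc Fa Fm).
exact: (function_ring_adj Fc Fa Fm).
Qed.

Variables (a b : R) (Q : R -> 'M[R]_n.+1) (V : 'M[R]_n.+1) (s : 'S_n.+1).
Hypothesis V_upper : upper V.
Hypothesis V_unidiag : unidiag V.
Hypothesis Q_ac : forall i j, abs_cont_bounded a b (fun t => Q t i j).
Hypothesis Q_unit : forall t, t \in `[a, b] -> Q t \in unitmx.
Hypothesis Q_chart : forall t, t \in `[a, b] ->
  \forall x \near t, lu_chart (Q x *m V).

Hypothesis Q_derive : {ae mu, forall t, t \in `[a, b] -> exists K : 'M[R]_n.+1,
  [/\ forall i j, is_derive t (1 : R) (fun x => Q x i j) ((Q t *m K) i j),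
      forall r c : 'I_n.+1, (c.+1 < r)%N -> K r c = 0 &
      forall j, 0 < K (hi j) (lo j)]}.

Definition lu_lower (t : R) := Q t *m V *m lu_upper (Q t *m V).

Let chart_at t : t \in `[a, b] -> lu_chart (Q t *m V).
Proof. by move=> /Q_chart; apply: nbhs_singleton. Qed.

Lemma coord_absolutely_continuous J :
  abs_cont_bounded a b (fun t => coord s (lu_lower t) J).
Proof.
pose F := abs_cont_bounded a b.
have Fc c : F (fun=> c) := abs_cont_bounded_cst a b c.
have Fa := @abs_cont_bounded_add R a b.
have Fm := @abs_cont_bounded_mul R a b.
have FX i j : F (fun t => (Q t *m V) i j).
  by apply: (function_ring_mulmx Fc Fa Fm) => // ? ?; apply: Fc.
have Fl k i j : F (fun t => lead (Q t *m V) k i j).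
  under eq_fun do rewrite [lead _ _ _ _]mxE.
  case: (_ && _); [exact: FX | exact: Fc].
have Fu i j : F (fun t => lu_upper (Q t *m V) i j).
  under eq_fun do rewrite [lu_upper _ _ _]mxE.
apply: (Fm).
    apply: (@abs_cont_bounded_inv _ _ _ _ 2^-1); rewrite ?invr_gt0 //.
      move=> t ta tb; have /chart_at/(_ j)[H _] : t \in `[a, b] by rewrite in_itv /= ta.
      exact: ltW.
    exact: (function_ring_det Fc Fa Fm).
  exact: (function_ring_adj Fc Fa Fm).
have FL i j : F (fun t => lu_lower t i j) by exact: (function_ring_mulmx Fc Fa Fm).
rewrite /coord; apply: (Fm); first exact: Fc.
apply: (function_ring_det Fc Fa Fm) => i j.
by under eq_fun do rewrite 2!mxE.
Qed.

Lemma coord_is_derive : {ae mu, forall t, t \in `[a, b] ->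
  exists beta : 'I_n -> R, (forall j, 0 < beta j) /\
    forall J, is_derive t (1 : R) (fun x => coord s (lu_lower x) J)
      (\sum_(j | (lo j \in J) && (hi j \notin J))
         beta j * coord s (lu_lower t) (raise J j))}.
Proof.
apply: ae_imply Q_derive => t + tab => /(_ tab)[K [dQ Kh Kpos]].
pose Y x := lu_upper (Q x *m V).
have chart := chart_at tab; have cu := lu_chart_unit chart.
have [Yu Ll L1 Y0] := lu_upperP cu.
have V0 : V \in unitmx.
  by rewrite unit_upper //; apply/forallP => r; rewrite V_unidiag oner_neq0.
have DX i j : is_derive t (1 : R) (fun x => (Q x *m V) i j) ((Q t *m K *m V) i j).
  have := is_derive_mulmx dQ (is_derive_cst_mx V t) i j.
  by rewrite mulmx0 addr0.
have dY i j : derivable (fun x => Y x i j) t 1.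
  apply: derivable_lu_upper => [c|i' j']; last by case: (DX i' j').
  by have := cu c; rewrite unitmxE unitfE.
pose dYt : 'M[R]_n.+1 := \matrix_(i, j) 'D_1 (fun x => Y x i j) t.
have DY i j : is_derive t (1 : R) (fun x => Y x i j) (dYt i j).
  by rewrite mxE; apply: derivableP.
pose L' := Q t *m (K *m (V *m Y t) + V *m dYt).
have DL i j : is_derive t (1 : R) (fun x => lu_lower x i j) (L' i j).
  have := is_derive_mulmx DX DY i j; rewrite /L' mulmxDr !mulmxA; exact.
have near_chart := Q_chart tab.
have dYu : upper dYt.
  move=> i j ji; apply: is_derive_near_cst (DY i j).
  by apply: filterS near_chart => x /lu_chart_unit/lu_upperP[+ _ _ _]; apply.
have L'l (i j : 'I_n.+1) : (i <= j)%N -> L' i j = 0.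
  move=> ij; apply: (@is_derive_near_cst _ (i == j)%:R _ _ _ (DL i j)).
  apply: filterS near_chart => x /lu_chart_unit/lu_upperP[_ Lx L1x _].
  have [->|nij] := eqVneq i j; first exact: L1x.
  by apply: Lx; rewrite ltn_neqAle ij andbT.
have LE : lu_lower t = Q t *m (V *m Y t) by rewrite mulmxA.
have U0 : V *m Y t \in unitmx by rewrite unitmx_mul V0.
have Uu : upper (V *m Y t) by apply: upper_mul.
have U'u : upper (V *m dYt) by apply: upper_mul.
have Ud j : 0 < (V *m Y t) j j.
  by rewrite upper_mul_diag // V_unidiag mul1r; case: (chart j).
have Ll' : lower (Q t *m (V *m Y t)) by rewrite -LE.
have L1' : unidiag (Q t *m (V *m Y t)) by rewrite -LE.
have [HL Hmax] := subdiagonal_derivative (Q_unit tab) Uu U0 U'u Kh Ll' L1' L'l erefl.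
rewrite -LE in HL.
pose beta j := K (hi j) (lo j) * ((V *m Y t) (lo j) (lo j) / (V *m Y t) (hi j) (hi j)).
exists beta; split=> [j|J]; first by rewrite mulr_gt0 // divr_gt0.
rewrite -(coord_derivative s J HL Hmax).
have ek : size (enum J) = #|J| by rewrite -cardE.
pose A (M : 'M[R]_n.+1) := \matrix_(r < #|J|, c < #|J|)
  M (s (inord r)) (nth ord0 (enum J) c).
have AE M : set_minor (row_perm s M) J = \det (A M).
  by apply: minorE => // r c; rewrite !mxE.
have dA i j : is_derive t (1 : R) (fun x => A (lu_lower x) i j) (A L' i j).
  by rewrite mxE (_ : (fun x => _) = fun x => lu_lower x (s (inord i)) (nth ord0 (enum J) j));
    [exact: DL | apply/funext => x; rewrite mxE].
have := is_deriveZ (set_minor (row_perm s 1%:M) (flag_rows s #|J|)) (is_derive_det dA).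
rewrite (_ : _ \*: _ = fun x => coord s (lu_lower x) J); last first.
  by apply/funext => x; rewrite /coord AE.
move=> /is_derive_eq; apply; congr (_ * _); apply: eq_bigr => c _.
by congr (\det _); apply/matrixP => i j; rewrite !mxE.
Qed.

End CurveCoordinates.

Section Flow.
Context {R : realType} {n : nat}.
Local Notation mu := (@lebesgue_measure R).
Variables (a b : R) (I : nat -> {set 'I_n.+1}) (q : {set 'I_n.+1} -> R -> R).
Hypothesis q_ac : forall J, absolutely_continuous a b (q J).
Hypothesis q_top : forall t (J : {set 'I_n.+1}), t \in `[a, b] -> J = I #|J| -> 0 < q J t.
Hypothesis q_gale : forall t (J : {set 'I_n.+1}), t \in `[a, b] -> ~ gale J (I #|J|) -> q J t = 0.

Let flow (J : {set 'I_n.+1}) t (beta : 'I_n -> R) :=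
  \sum_(j | (lo j \in J) && (hi j \notin J)) beta j * q (raise J j) t.

Let raise_ind (D : set R) : D `<=` `[a, b] ->
  (forall J : {set 'I_n.+1}, gale J (I #|J|) -> J <> I #|J| ->
    (forall t beta, D t -> (forall j, 0 < beta j) -> 0 < flow J t beta) ->
    forall t, D t -> 0 < q J t) ->
  forall J : {set 'I_n.+1}, gale J (I #|J|) -> forall t, D t -> 0 < q J t.
Proof.
move=> Dab H J; have [m] := ubnP (n.+1 * n.+1 - weight J).
elim: m J => // m IH J Jm gJ.
have [eJ|nJ] := eqVneq J (I #|J|); first by move=> t /Dab Dt; apply: q_top.
apply: H => //; first exact/eqP.
have IHr j t : lo j \in J -> hi j \notin J -> gale (raise J j) (I #|J|) ->
    D t -> 0 < q (raise J j) t.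
  move=> lJ hJ gr Dt; apply: IH => //; rewrite ?card_raise //.
  have : (weight (raise J j) <= n.+1 * n.+1)%N.
    apply: (@leq_trans (\sum_(i in raise J j) n.+1)).
      by apply: leq_sum => i _; apply: ltnW.
    by rewrite sum_nat_const leq_mul // -[X in (_ <= X)%N]card_ord max_card.
  by rewrite weight_raise //; lia.
move=> t beta Dt b0; have [j [lJ hJ gr]] := gale_step gJ nJ.
rewrite /flow (bigD1 j) /= ?lJ ?hJ // ltr_wpDr ?mulr_gt0 //; last exact: IHr.
apply: sumr_ge0 => k /andP[/andP[lk hk] _]; apply: mulr_ge0; first exact: ltW.
have [gk|gk] := pselect (gale (raise J k) (I #|J|)).
  by apply: ltW; apply: IHr.
by rewrite q_gale ?card_raise //; apply: Dab.
Qed.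

Let flow_ge0 J t beta : (forall K, 0 <= q K t) -> (forall j, 0 < beta j) ->
  0 <= flow J t beta.
Proof.
by move=> q0 b0; apply: sumr_ge0 => j _; apply: mulr_ge0 => //; apply: ltW.
Qed.

Lemma flow_forward_positive : (forall J, 0 <= q J a) ->
  {ae mu, forall t, t \in `[a, b] -> exists beta : 'I_n -> R,
    (forall j, 0 < beta j) /\
    forall J, is_derive t (1 : R) (q J)
      (\sum_(j | (lo j \in J) && (hi j \notin J)) beta j * q (raise J j) t)} ->
  forall J : {set 'I_n.+1}, gale J (I #|J|) -> forall t, a < t -> t <= b -> 0 < q J t.
Proof.
move=> q0 aeq J0 gJ0 t0 at0 t0b.
apply: (@raise_ind `]a, b]%classic _ _ J0 gJ0); last by rewrite /= in_itv /= at0.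
  exact: subset_itv_oc_cc.
move=> J _ _ flow_pos t; rewrite /= in_itv /= => /andP[at_ tb].
pose c := (a + t) / 2.
have ac : a < c by rewrite midf_lt.
have ct : c < t by rewrite midf_lt.
have qc : 0 <= q J c.
  apply: le_trans (q0 J) _.
  apply: (absolutely_continuous_nondecreasing (ltW ac)).
    by apply: absolutely_continuous_sub (q_ac J) => //; apply: ltW (lt_le_trans ct tb).
  apply: ae_imply aeq => u + uac; move: uac; rewrite in_itv /= => /andP[au uc].
  have ub : u <= b by apply: le_trans uc (ltW (lt_le_trans ct tb)).
  rewrite in_itv /= au ub => /(_ isT)[beta [b0 /(_ J) dq]].
  exists (flow J u beta) => //.
  have [->|nau] := eqVneq u a; first exact: flow_ge0.
  by apply/ltW/flow_pos => //; rewrite /= in_itv /= ub andbT lt_neqAle eq_sym nau.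
apply: le_lt_trans qc _; apply: (absolutely_continuous_increasing ct).
  by apply: absolutely_continuous_sub (q_ac J) => //; apply: ltW.
apply: ae_imply aeq => u + uct; move: uct; rewrite in_itv /= => /andP[cu ut].
have au : a < u by apply: lt_le_trans cu.
have ub : u <= b by apply: le_trans ut tb.
rewrite in_itv /= (ltW au) ub => /(_ isT)[beta [b0 /(_ J) dq]].
exists (flow J u beta) => //.
by apply/flow_pos => //; rewrite /= in_itv /= ub au.
Qed.

Lemma flow_backward_positive : (forall J, 0 <= q J b) ->
  {ae mu, forall t, t \in `[a, b] -> exists beta : 'I_n -> R,
    (forall j, 0 < beta j) /\
    forall J, is_derive t (1 : R) (q J)
      (- \sum_(j | (lo j \in J) && (hi j \notin J)) beta j * q (raise J j) t)} ->
  forall J : {set 'I_n.+1}, gale J (I #|J|) -> forall t, a <= t -> t < b -> 0 < q J t.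
Proof.
move=> q0 aeq J0 gJ0 t0 at0 t0b.
apply: (@raise_ind `[a, b[%classic _ _ J0 gJ0); last by rewrite /= in_itv /= at0.
  exact: subset_itv_co_cc.
have acN c d f : absolutely_continuous c d f ->
    absolutely_continuous c d (fun x : R => - f x).
  move=> H e e0; have [delta d0 Hd] := H e e0; exists delta => // m x y xy tr s.
  under eq_bigr do rewrite -opprD normrN; exact: Hd.
have dN f u d : is_derive u (1 : R) f (- d) -> is_derive u (1 : R) (fun x : R => - f x) d.
  by move=> H; apply: is_derive_eq (is_deriveN H) _; rewrite opprK.
move=> J _ _ flow_pos t; rewrite /= in_itv /= => /andP[at_ tb].
pose c := (t + b) / 2.
have tc : t < c by rewrite midf_lt.
have cb : c < b by rewrite midf_lt.
have qc : 0 <= q J c.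
  apply: le_trans (q0 J) _; rewrite -lerN2.
  apply: (absolutely_continuous_nondecreasing (f := fun x => - q J x) (ltW cb)).
    by apply/acN/(absolutely_continuous_sub _ _ (q_ac J)); rewrite // (le_trans at_ (ltW tc)).
  apply: ae_imply aeq => u + ucb; move: ucb; rewrite in_itv /= => /andP[cu ub].
  have au : a <= u by apply: le_trans (le_trans at_ (ltW tc)) cu.
  rewrite in_itv /= au ub => /(_ isT)[beta [b0 /(_ J) dq]].
  exists (flow J u beta); last exact: dN.
  have [->|nub] := eqVneq u b; first exact: flow_ge0.
  by apply/ltW/flow_pos => //; rewrite /= in_itv /= au lt_neqAle nub.
apply: le_lt_trans qc _; rewrite -ltrN2.
apply: (absolutely_continuous_increasing (f := fun x => - q J x) tc).
  by apply/acN/(absolutely_continuous_sub _ _ (q_ac J)) => //; apply: ltW.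
apply: ae_imply aeq => u + utc; move: utc; rewrite in_itv /= => /andP[tu uc].
have au : a <= u by apply: le_trans at_ tu.
have ub : u < b by apply: le_lt_trans uc cb.
rewrite in_itv /= au (ltW ub) => /(_ isT)[beta [b0 /(_ J) dq]].
exists (flow J u beta); last exact: dN.
by apply/flow_pos => //; rewrite /= in_itv /= ub au.
Qed.

End Flow.

(** * Local connectedness *)

Section ContinuousMatrix.
Context {R : realType} {T : topologicalType}.

Lemma cvg_mx m p (F : T -> 'M[R]_(m.+1, p.+1)) (x : T) :
  (forall i j, F y i j @[y --> x] --> F x i j) -> F y @[y --> x] --> F x.
Proof.
move=> H; apply/cvg_ballP => e e0; near=> y; split=> // i j; move: i j.
near: y; apply: filter_forall => i; apply: filter_forall => j.
exact: (cvg_ballP _ _).1 (H i j) e e0.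
Unshelve. all: by end_near. Qed.

Variable x : T.

Let cont (f : T -> R) := f y @[y --> x] --> f x.

Lemma cont_cst c : cont (fun=> c). Proof. exact: cvg_cst. Qed.
Lemma cont_add f g : cont f -> cont g -> cont (fun y => f y + g y).
Proof. by move=> Hf Hg; apply: cvgD. Qed.
Lemma cont_mul f g : cont f -> cont g -> cont (fun y => f y * g y).
Proof. by move=> Hf Hg; apply: cvgM. Qed.

Lemma cont_det m (A : T -> 'M[R]_m) :
  (forall i j, cont (fun y => A y i j)) -> cont (fun y => \det (A y)).
Proof. exact: (function_ring_det cont_cst cont_add cont_mul). Qed.

Lemma cont_mulmx m p q (A : T -> 'M[R]_(m, p)) (B : T -> 'M[R]_(p, q)) :
  (forall i j, cont (fun y => A y i j)) -> (forall i j, cont (fun y => B y i j)) ->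
  forall i j, cont (fun y => (A y *m B y) i j).
Proof. exact: (function_ring_mulmx cont_cst cont_add cont_mul). Qed.

Lemma cont_adj m (A : T -> 'M[R]_m) :
  (forall i j, cont (fun y => A y i j)) ->
  forall i j, cont (fun y => (\adj (A y)) i j).
Proof. exact: (function_ring_adj cont_cst cont_add cont_mul). Qed.

Lemma cont_inv_mx m (A : T -> 'M[R]_m) :
  (forall i j, cont (fun y => A y i j)) -> \det (A x) != 0 ->
  forall i j, cont (fun y => ((\det (A y))^-1 *: \adj (A y)) i j).
Proof.
move=> HA A0 i j.
have -> : (fun y => ((\det (A y))^-1 *: \adj (A y)) i j) =
    (fun y => (\det (A y))^-1 * (\adj (A y)) i j).
  by apply/funext => y; rewrite [LHS]mxE.
by apply: cont_mul; [apply: cvgV => //; exact: cont_det | exact: cont_adj].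
Qed.

End ContinuousMatrix.

Section Cayley.
Context {R : realType} {n : nat}.
Implicit Types X N : 'M[R]_n.+1.

Definition cayley X : 'M[R]_n.+1 := (1%:M - X) *m ((\det (1%:M + X))^-1 *: \adj (1%:M + X)).

Lemma cayleyE X : 1%:M + X \in unitmx -> cayley X = (1%:M - X) *m invmx (1%:M + X).
Proof. by move=> uX; rewrite /cayley /invmx uX. Qed.

Lemma cayley_continuous X : 1%:M + X \in unitmx -> {for X, continuous cayley}.
Proof.
move=> uX; apply: cvg_mx; apply: cont_mulmx => [i j|].
  have -> : (fun y : 'M[R]_n.+1 => (1%:M - y) i j) = (fun y => (1%:M : 'M[R]_n.+1) i j + -1 * y i j).
    by apply/funext => y; rewrite !mxE mulN1r.
  rewrite (_ : (1%:M - X) i j = (1%:M : 'M[R]_n.+1) i j + -1 * X i j); last by rewrite !mxE mulN1r.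
  apply: cont_add; first exact: cont_cst.
  by apply: cont_mul; [exact: cont_cst | exact: coord_continuous].
apply: cont_inv_mx; last by move: uX; rewrite unitmxE unitfE.
move=> i j; have -> : (fun y : 'M[R]_n.+1 => (1%:M + y) i j) = (fun y => (1%:M : 'M[R]_n.+1) i j + y i j).
  by apply/funext => y; rewrite !mxE.
rewrite (_ : (1%:M + X) i j = (1%:M : 'M[R]_n.+1) i j + X i j); last by rewrite !mxE.
by apply: cont_add; [exact: cont_cst | exact: coord_continuous].
Qed.

Lemma skew_unit X : X^T = - X -> 1%:M + X \in unitmx.
Proof.
move=> sX; rewrite unitmxE unitfE; apply/negP => /det0P[v v0 vX].
have e : v *m v^T + v *m X *m v^T = 0.
  by rewrite -mulmxDl -{1}[v]mulmx1 -mulmxDr vX mul0mx.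
have q0 : (v *m X *m v^T) 0 0 = 0.
  have : (v *m X *m v^T)^T = - (v *m X *m v^T).
    by rewrite !trmx_mul trmxK sX mulNmx mulmxN mulmxA.
  by move=> /matrixP/(_ 0 0); rewrite !mxE; lra.
have := congr1 (fun A : 'M[R]_1 => A 0 0) e; rewrite [LHS]mxE q0 addr0 !mxE => s0.
case/eqP: v0; apply/rowP => i; rewrite mxE; apply/eqP.
have /psumr_eq0P : forall j, true -> 0 <= v 0 j * (v^T) j 0.
  by move=> j _; rewrite mxE -expr2 sqr_ge0.
by move=> /(_ s0 i isT)/eqP; rewrite mxE mulf_eq0 orbb.
Qed.

Let comm_add_sub X : (1%:M + X) *m (1%:M - X) = (1%:M - X) *m (1%:M + X).
Proof.
rewrite mulmxDl mulmxBl !mul1mx mulmxBr mulmxDr mulmx1.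
by move: (X *m X) => Y; apply/matrixP => i j; rewrite !mxE; ring.
Qed.

Lemma cayley_SO X : X^T = - X -> @SO R n (cayley X).
Proof.
move=> sX; have uP := skew_unit sX; rewrite /= cayleyE //.
have tP : (1%:M + X)^T = 1%:M - X by rewrite linearD /= trmx1 sX.
have tM : (1%:M - X)^T = 1%:M + X by rewrite linearB /= trmx1 sX opprK.
have uM : 1%:M - X \in unitmx by rewrite -tP unitmx_tr.
split.
  have -> : (1%:M - X) *m invmx (1%:M + X) = invmx (1%:M + X) *m (1%:M - X).
    apply: (can_inj (mulKmx uP)).
    by rewrite mulmxA comm_add_sub mulmxK // mulKVmx.
  rewrite trmx_mul trmx_inv tP tM -mulmxA [X in _ *m X = _]mulmxA.
  by rewrite -comm_add_sub mulmxK // mulVmx.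
rewrite det_mulmx det_inv -tP det_tr mulfV //.
by move: uP; rewrite unitmxE unitfE.
Qed.

Lemma cayley_skew N : N *m N^T = 1%:M -> 1%:M + N \in unitmx ->
  (cayley N)^T = - cayley N /\ cayley (cayley N) = N.
Proof.
move=> NN uN; have uN' : N \in unitmx by have [] := mulmx1_unit NN.
have tN : N^T = invmx N by rewrite -[LHS]mul1mx -(mulVmx uN') -mulmxA NN mulmx1.
have c : cayley N = (1%:M - N) *m invmx (1%:M + N) by rewrite cayleyE.
have P : 1%:M + cayley N = 2 *: invmx (1%:M + N).
  rewrite c -{1}(mulmxV uN) -mulmxDl -{2}[invmx _]mul1mx scalemxAl.
  by congr (_ *m _); apply/matrixP => i j; rewrite !mxE; ring.
have Q : 1%:M - cayley N = 2 *: (N *m invmx (1%:M + N)).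
  rewrite c -{1}(mulmxV uN) -mulmxBl scalemxAl.
  by congr (_ *m _); apply/matrixP => i j; rewrite !mxE; ring.
split; last first.
  have u2 : 2 *: invmx (1%:M + N) \in unitmx.
    by rewrite unitmxZ ?unitmx_inv // unitfE.
  rewrite cayleyE ?P ?Q // invmxZ // invmxK -scalemxAl -scalemxAr scalerA mulfV //.
  by rewrite scale1r mulmxKV.
have uNV : 1%:M + N^T \in unitmx by rewrite -trmx1 -linearD unitmx_tr.
apply: (can_inj (mulKmx uNV)).
rewrite c trmx_mul trmx_inv linearD linearB /= trmx1 mulKVmx //.
apply: (can_inj (mulmxK uN)).
rewrite mulmxN mulNmx -!mulmxA mulVmx // mulmx1 -mulmxN opprB.
rewrite !mulmxDl !mul1mx !mulmxDr !mulNmx !mulmxN !mulmx1 (mulmx1C NN).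
by apply/matrixP => i j; rewrite !mxE; ring.
Qed.

End Cayley.

Lemma connected_component_open (T : topologicalType) :
  (forall (D : set T) z, open D -> D z ->
    exists Q, [/\ connected Q, Q `<=` D & nbhs z Q]) ->
  forall (D : set T) z, open D -> open (connected_component D z).
Proof.
move=> lc D z oD; rewrite openE => y Dzy.
have Dy : D y by apply: connected_component_sub Dzy.
have [Q [cQ QD Qy]] := lc D y oD Dy.
have Qyy := nbhs_singleton Qy.
rewrite /interior (same_connected_component Dzy); apply: filterS Qy.
exact: connected_component_max.
Qed.

Section LocallyConnected.
Context {R : realType} {n : nat}.
Implicit Types X A : 'M[R]_n.+1.

Let mulmx_continuous B : continuous (fun A => B *m A : 'M[R]_n.+1).
Proof.
move=> A; apply: cvg_mx; apply: cont_mulmx => i j; first exact: cont_cst.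
exact: coord_continuous.
Qed.

Lemma skew_ball_connected (r : R) : 0 < r ->
  connected [set X | X^T = - X /\ ball (0 : 'M[R]_n.+1) r X].
Proof.
move=> r0; set D := [set X | _].
have D0 : D 0 by split; [rewrite linear0 oppr0 | exact: ballxx].
pose seg X : set 'M[R]_n.+1 := (fun t : R => t *: X) @` `[0, 1].
have -> : D = \bigcup_(X in D) seg X.
  apply/seteqP; split=> [X DX|Y [X [sX rX] [t /=]]].
    by exists X => //; exists 1; rewrite ?scale1r //= in_itv /= ler01 lexx.
  rewrite in_itv /= => /andP[t0 t1] <-; split.
    by rewrite linearZ /= sX scalerN.
  move: rX; rewrite -!ball_normE /= !sub0r !normrN normrZ ger0_norm //.
  by apply: le_lt_trans; rewrite ler_piMl.
apply: bigcup_connected.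
  by exists 0 => X _; exists 0; rewrite ?scale0r //= in_itv /= ler01 lexx.
move=> X _; apply: connected_continuous_connected; first exact: segment_connected.
apply: continuous_subspaceT => t; exact: scalel_continuous.
Qed.

Lemma covering_locally_connected (T : topologicalType) (f : T -> 'M[R]_n.+1) :
  covering_map f (@SO R n) -> forall (D : set T) z, open D -> D z ->
  exists Q, [/\ connected Q, Q `<=` D & nbhs z Q].
Proof.
move=> [fc fB cov] D z oD Dz.
have fSO y : SO (f y) by rewrite -fB; exists y.
set A0 := f z; have [A0O A0d] : SO A0 := fSO z.
have [V [oV VA0 [S [_ SV HS]]]] := cov A0 (fSO z).
have [W SW Wz] : (\bigcup_(W in S) W) z by rewrite SV.
have [oW fW [g [gc gK]]] := HS W SW.
have gfz : g A0 = z by apply: gK; rewrite inE.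
pose phi X := A0 *m cayley X.
have phi_c X : 1%:M + X \in unitmx -> {for X, continuous phi}.
  move=> uX; apply: (@continuous_comp _ _ _ _ (fun A => A0 *m A)).
    exact: cayley_continuous.
  exact: mulmx_continuous.
have u0 : 1%:M + 0 \in (unitmx : {pred 'M[R]_n.+1}) by rewrite addr0 unitmx1.
have phi0 : phi 0 = A0.
  by rewrite /phi cayleyE // subr0 addr0 invmx1 !mulmx1.
have phi_SO X : X^T = - X -> SO (phi X).
  move=> /cayley_SO[cO cd]; split; last by rewrite det_mulmx cd A0d mulr1.
  by rewrite trmx_mul mulmxA -(mulmxA A0) cO mulmx1.
have gW A (P : set T) : V A -> SO A -> nbhs (g A) P ->
    \forall B \near A, V B -> SO B -> P (g B).
  move=> VA SA nP.
  have H : nbhs A [set B | (V `&` @SO R n) B -> P (g B)].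
    by move/subspace_continuousP: gc => /(_ A (conj VA SA)); apply.
  by apply: filterS H => B HB VB SB; apply: HB.
have : \forall X \near (0 : 'M[R]_n.+1), V (phi X) /\ (SO (phi X) -> D (g (phi X))).
  have nD : nbhs (g A0) D by rewrite gfz; apply: open_nbhs_nbhs.
  have := gW A0 D VA0 (fSO z) nD; rewrite -phi0 => H1.
  have nV : nbhs (phi 0) V by rewrite phi0; apply: open_nbhs_nbhs.
  have H2 : nbhs (0 : 'M[R]_n.+1) (phi @^-1` (V `&` [set B | V B -> SO B -> D (g B)])).
    by apply: (phi_c 0 u0); apply: filterI.
  by apply: filterS H2 => X [VX HX]; split=> // SX; apply: HX.
move=> /nbhs_ballP[r /= r0 Hr].
pose E := [set X | X^T = - X /\ ball (0 : 'M[R]_n.+1) r X].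
exists ((g \o phi) @` E); split.
- apply: connected_continuous_connected; first exact: skew_ball_connected.
  apply/subspace_continuousP => X [sX rX] P nP.
  have [VX _] := Hr X rX.
  have H : nbhs X (phi @^-1` [set B | V B -> SO B -> P (g B)]).
    by apply: (phi_c X (skew_unit sX)); apply: gW VX (phi_SO X sX) nP.
  apply: filterS H => Y HY [sY rY]; have [VY _] := Hr Y rY.
  by apply: HY => //; apply: phi_SO.
- move=> _ [X [sX rX] <-]; have [_ H] := Hr X rX.
  by apply: H; apply: phi_SO.
have A0t : A0^T *m A0 = 1%:M by apply: mulmx1C.
pose psi A := cayley (A0^T *m A).
have u11 : 1%:M + 1%:M \in (unitmx : {pred 'M[R]_n.+1}).
  by rewrite -raddfD unitmxE det_scalar unitfE expf_neq0.
have psi_c : {for A0, continuous psi}.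
  apply: (@continuous_comp _ _ _ (fun A => A0^T *m A)).
    exact: mulmx_continuous.
  by apply: cayley_continuous; rewrite A0t.
have psi0 : psi A0 = 0.
  by rewrite /psi A0t cayleyE // subrr mul0mx.
have nW : nbhs z W by apply: open_nbhs_nbhs.
have nr : \forall A \near A0, ball (0 : 'M[R]_n.+1) r (psi A).
  by apply: psi_c; rewrite psi0; apply: nbhsx_ballx.
have nu : \forall A \near A0, 1%:M + A0^T *m A \in unitmx.
  have : {for A0, continuous (fun A => \det (1%:M + A0^T *m A))}.
    apply: cont_det => i j.
    have -> : (fun A => (1%:M + A0^T *m A) i j) =
        fun A => (1%:M : 'M[R]_n.+1) i j + (A0^T *m A) i j.
      by apply/funext => A; rewrite [LHS]mxE.
    rewrite [X in _ --> X]mxE; apply: cont_add; first exact: cont_cst.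
    by apply: cont_mulmx => k l; [exact: cont_cst | exact: coord_continuous].
  move=> /(_ [set x | x != 0]); case.
    apply: open_nbhs_nbhs; split; first exact: open_neq.
    by move: u11; rewrite /= A0t unitmxE unitfE.
  move=> e /= e0 He; exists e => //= A /He /=.
  by rewrite unitmxE unitfE.
have H : nbhs z (f @^-1` [set A | ball (0 : 'M[R]_n.+1) r (psi A) /\
    1%:M + A0^T *m A \in unitmx]) by apply: (fc z); apply: filterI.
apply: filterS (filterI nW H) => y [Wy [ry uy]].
have [fyO _] := fSO y.
have NN : (A0^T *m f y) *m (A0^T *m f y)^T = 1%:M.
  by rewrite trmx_mul trmxK mulmxA -(mulmxA A0^T) fyO mulmx1.
have [sX XK] := cayley_skew NN uy.
exists (psi (f y)) => //=.
rewrite /phi XK mulmxA (_ : A0 *m A0^T = 1%:M) // mul1mx.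
by apply: gK; rewrite inE.
Qed.

End LocallyConnected.

(** * Crossing a singular point *)

Section ChartContinuity.
Context {R : realType} {n : nat} {T : topologicalType}.
Variables (X : T -> 'M[R]_n.+1) (z : T).
Hypothesis X_cont : forall i j, X y i j @[y --> z] --> X z i j.

Let lead_cont k i j : lead (X y) k i j @[y --> z] --> lead (X z) k i j.
Proof.
rewrite mxE; under eq_fun do rewrite mxE.
by case: (_ && _); [exact: X_cont | exact: cvg_cst].
Qed.

Let lu_upper_cont i j : lu_chart (X z) ->
  lu_upper (X y) i j @[y --> z] --> lu_upper (X z) i j.
Proof.
move=> /lu_chart_unit/(_ j) uz.
have -> : (fun y => lu_upper (X y) i j) =
    (fun y => ((\det (lead (X y) j.+1))^-1 *: \adj (lead (X y) j.+1)) i j).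
  by apply/funext => y; rewrite [LHS]mxE [RHS]mxE.
rewrite (_ : lu_upper (X z) i j =
    ((\det (lead (X z) j.+1))^-1 *: \adj (lead (X z) j.+1)) i j); last first.
  by rewrite [LHS]mxE [RHS]mxE.
by apply: cont_inv_mx; rewrite // -?unitfE -?unitmxE.
Qed.

Lemma lu_chart_near : lu_chart (X z) -> \forall y \near z, lu_chart (X y).
Proof.
move=> cz; apply: filter_forall => c.
have lt_near (f : T -> R) (d : R) : f y @[y --> z] --> f z -> d < f z ->
    \forall y \near z, d < f y by move=> fc dz; apply: (cvgr_gt _ fc).
apply: filterI.
  apply: (lt_near (fun y => \det (lead (X y) c.+1))); last by case: (cz c).
  by apply: cont_det => i j; apply: lead_cont.
apply: (lt_near (fun y => lu_upper (X y) c c)); last by case: (cz c).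
exact: lu_upper_cont.
Qed.

Lemma coord_lu_cont s J : lu_chart (X z) ->
  coord s (X y *m lu_upper (X y)) J @[y --> z] --> coord s (X z *m lu_upper (X z)) J.
Proof.
move=> cz; apply: cvgM; first exact: cvg_cst.
pose A y := \matrix_(r < size (enum J), c < size (enum J))
  row_perm s (X y *m lu_upper (X y)) (inord r) (nth ord0 (enum J) c).
apply: (cont_det (A := A)) => i j.
have E y : A y i j = (X y *m lu_upper (X y)) (s (inord i)) (nth ord0 (enum J) j).
  by rewrite [LHS]mxE [LHS]mxE.
rewrite E (funext E : (fun y => A y i j) = _).
by apply: cont_mulmx => // k l; apply: lu_upper_cont.
Qed.

End ChartContinuity.

Section SpecialOrthogonal.
Context {R : realType} {n : nat}.
Implicit Types A : 'M[R]_n.+1.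

Lemma SO_unit A : SO A -> A \in unitmx.
Proof. by case=> /mulmx1_unit[]. Qed.

Lemma SO_entry_le1 A i j : SO A -> `|A i j| <= 1.
Proof.
move=> [AA _]; rewrite -(@ler_pXn2r _ 2) ?nnegrE // expr1n real_normK ?num_real //.
have := congr1 (fun M : 'M[R]_n.+1 => M i i) AA; rewrite !mxE eqxx /= => AA1.
rewrite -[leRHS]AA1.
rewrite (bigD1 j) //= mxE expr2 lerDl; apply: sumr_ge0 => k _.
by rewrite mxE -expr2 sqr_ge0.
Qed.

End SpecialOrthogonal.

Section CurveChart.
Context {R : realType} {n : nat} {G : topologicalGroupType}.
Variable Pi : G -> 'M[R]_n.+1.
Hypothesis Pi_continuous : continuous Pi.
Hypothesis Pi_SO : forall z, SO (Pi z).
Local Notation mu := (@lebesgue_measure R).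

Variables (U V : 'M[R]_n.+1) (s : 'S_n.+1).
Hypotheses (U_upper : upper U) (U_unit : U \in unitmx).
Hypotheses (V_upper : upper V) (V_unidiag : unidiag V).

Let sg := (@eta n * s)%g.
Let C := invmx (perm_mx s) *m U.
Let Q (z : G) := C *m Pi z.

(* [chart_lower] is the chart. The matrices U, V and s will come from the Bruhat
   decomposition [U *m Pi z *m V = perm_mx s] of the singular point z, which is
   thus sent to 1. *)
Definition chart_domain : set G := [set z | lu_chart (Q z *m V)].
Definition chart_lower (z : G) := Q z *m V *m lu_upper (Q z *m V).
Definition chart_coord (z : G) (J : {set 'I_n.+1}) := coord sg (chart_lower z) J.

Let C_unit : C \in unitmx.
Proof. by rewrite unitmx_mul unitmx_inv unitmx_perm U_unit. Qed.

Let Q_unit z : Q z \in unitmx.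
Proof. by rewrite unitmx_mul C_unit SO_unit. Qed.

Let V_unit : V \in unitmx.
Proof. by rewrite unit_upper //; apply/forallP => r; rewrite V_unidiag oner_neq0. Qed.

Let QV_cont z i j : (Q y *m V) i j @[y --> z] --> (Q z *m V) i j.
Proof.
apply: cont_mulmx => [k l|k l]; last exact: cont_cst.
apply: cont_mulmx => [k' l'|k' l']; first exact: cont_cst.
by apply: (@cvg_comp _ _ _ Pi (fun M : 'M[R]_n.+1 => M k' l'));
  [exact: Pi_continuous | exact: coord_continuous].
Qed.

Lemma chart_domain_open : open chart_domain.
Proof. by rewrite openE => z cz; exact: (lu_chart_near (@QV_cont z) cz). Qed.

Lemma chart_coord_continuous z J : chart_domain z ->
  chart_coord y J @[y --> z] --> chart_coord z J.
Proof. by move=> cz; exact: (coord_lu_cont (@QV_cont z) cz). Qed.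

Lemma chart_lowerP z : chart_domain z ->
  lower (chart_lower z) /\ unidiag (chart_lower z).
Proof. by move=> /lu_chart_unit/lu_upperP[]. Qed.

Lemma Bru_etaP z : chart_domain z -> Bru_eta Pi z <->
  forall k, (k <= n.+1)%N -> chart_coord z (init n.+1 k) != 0.
Proof.
move=> cz; have [Yu _ _ Y0] := lu_upperP (lu_chart_unit cz).
have Xu : upper (V *m lu_upper (Q z *m V)) by apply: upper_mul.
have X0 : V *m lu_upper (Q z *m V) \in unitmx by rewrite unitmx_mul V_unit.
have := big_cellP (Pi z) s U_upper U_unit Xu X0.
rewrite (_ : _ *m _ *m _ = chart_lower z); last by rewrite /chart_lower /Q /C !mulmxA.
rewrite -/(@eta n) -/sg => <-.
by split=> -[W0 [W1 [[W0u W00] [W1u W10] E]]]; exists W0, W1; split=> //; split=> //;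
  apply/is_trig_upper.
Qed.

Lemma chart_regular_open : open (chart_domain `&` Bru_eta Pi).
Proof.
rewrite openE => z [cz /(Bru_etaP cz) Bz].
have near_chart : nbhs z chart_domain := lu_chart_near (@QV_cont z) cz.
have near_neq0 : \forall y \near z, forall k : 'I_n.+2,
    chart_coord y (init n.+1 k) != 0.
  apply: filter_forall => k.
  apply: (@chart_coord_continuous z (init n.+1 k) cz [set x | x != 0]).
  by apply: open_nbhs_nbhs; split; [exact: open_neq | exact: Bz (ltn_ord k)].
apply: filterS (filterI near_chart near_neq0) => y [cy y0]; split=> //.
by apply/(Bru_etaP cy) => k kn; apply: (y0 (Ordinal (kn : (k < n.+2)%N))).
Qed.

Lemma chart_coord_gale z J : chart_domain z -> ~ gale J (flag_rows sg #|J|) ->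
  chart_coord z J = 0.
Proof.
move=> /chart_lowerP[Ll _] nJ; apply/eqP/negPn/negP => /(coord_gale Ll).
exact: nJ.
Qed.

Definition chart_future : set G := [set z | chart_domain z /\
  forall J : {set 'I_n.+1}, gale J (flag_rows sg #|J|) -> 0 < chart_coord z J].

Lemma chart_future_open : open chart_future.
Proof.
rewrite openE => z [cz pz].
apply: filterI; first exact: (lu_chart_near (@QV_cont z) cz).
apply: filter_forall => J; have [gJ|nJ] := pselect (gale J (flag_rows sg #|J|)).
  have H : \forall y \near z, 0 < chart_coord y J.
    by apply: (cvgr_gt _ (@chart_coord_continuous z J cz)); apply: pz.
  by apply: filterS H.
by apply: nearW => y /nJ.
Qed.

Lemma chart_future_closed : exists2 F : set G, closed F &
  chart_domain `&` Bru_eta Pi `&` chart_future = chart_domain `&` Bru_eta Pi `&` F.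
Proof.
exists (~` [set z | chart_domain z /\ exists J, chart_coord z J < 0]).
  apply: open_closedC; rewrite openE => z [cz [J Jz]].
  apply: filterI; first exact: (lu_chart_near (@QV_cont z) cz).
  have H : \forall y \near z, chart_coord y J < 0.
    by apply: (cvgr_lt _ (@chart_coord_continuous z J cz)).
  by apply: filterS H => y Jy; exists J.
apply/seteqP; split=> z [[cz Bz] Hz]; split=> //.
  move=> [_ [J]]; have [gJ|nJ] := pselect (gale J (flag_rows sg #|J|)).
    by rewrite ltNge (ltW (Hz.2 J gJ)).
  by rewrite chart_coord_gale // ltxx.
split=> //; have [Ll L1] := chart_lowerP cz.
apply: coord_positive => //; first exact/(Bru_etaP cz).1.
move=> J; rewrite leNgt; apply/negP => Jz; apply: Hz; split=> //.
by exists J.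
Qed.

Lemma chart_future_component z y :
  z \in chart_domain `&` Bru_eta Pi -> chart_future z ->
  connected_component (chart_domain `&` Bru_eta Pi) z y -> chart_future y.
Proof.
set O := chart_domain `&` Bru_eta Pi; move=> zO fz zy.
set K := connected_component O z in zy *.
have KO : K `<=` O by apply: connected_component_sub.
have cK : connected K by apply: component_connected.
have Kz : K z by apply: connected_component_refl; rewrite inE in zO.
have [F cF] := chart_future_closed; rewrite -/O => EF.
suff E : K `&` chart_future = K by move: zy; rewrite -E => -[].
apply: cK; first by exists z.
  by exists chart_future => //; exact: chart_future_open.
exists F => //; have -> : K = K `&` O by rewrite setIidl.
by rewrite -(setIA K O) EF setIA.
Qed.

Lemma locally_convex_continuous (Gamma : R -> G) (kappa : 'I_n -> R -> R) (t : R) :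
  locally_convex_with Pi 0 1 Gamma kappa -> t \in `]0, 1[ ->
  Gamma x @[x --> t] --> Gamma t.
Proof.
move=> [/subspace_continuousP cG _ _ _] t01 P nP.
have H : nbhs t [set x | `[0, 1]%classic x -> P (Gamma x)].
  by apply: (cG t) => //; apply: subset_itv_oo_cc.
have n01 : nbhs t `]0, 1[%classic by apply: open_nbhs_nbhs; split; [exact: interval_open|].
by apply: filterS (filterI n01 H) => x [x01 Hx]; apply: Hx; apply: subset_itv_oo_cc.
Qed.

Lemma locally_convex_derivative (Gamma : R -> G) (kappa : 'I_n -> R -> R) (t : R) :
  (forall j, 0 < kappa j t) -> derivable (Pi \o Gamma) t 1 ->
  logarithmic_derivative Pi Gamma t = \sum_j kappa j t *: fa j ->
  exists K : 'M[R]_n.+1,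
  [/\ forall i j, is_derive t (1 : R) (fun x => Q (Gamma x) i j) ((Q (Gamma t) *m K) i j),
      forall r c : 'I_n.+1, (c.+1 < r)%N -> K r c = 0 &
      forall j, 0 < K (hi j) (lo j)].
Proof.
move=> k0 dG logd; pose K : 'M[R]_n.+1 := \sum_j kappa j t *: fa j.
have KE r c : K r c = \sum_j kappa j t *
    (((r == hi j) && (c == lo j))%:R - ((r == lo j) && (c == hi j))%:R).
  by rewrite summxE; apply: eq_bigr => j _; rewrite !mxE.
exists K; split=> [i j|r c cr|j].
- have uPi := SO_unit (Pi_SO (Gamma t)).
  have dA : derive1 (Pi \o Gamma) t = Pi (Gamma t) *m K.
    by rewrite /K -logd /logarithmic_derivative mulKVmx.
  have dPi k l : is_derive t (1 : R) (fun x => Pi (Gamma x) k l) ((Pi (Gamma t) *m K) k l).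
    rewrite -dA derive1E derive_mx // mxE; apply: derivableP.
    by move/derivable_mxP: dG; apply.
  have := is_derive_mulmx (is_derive_cst_mx C t) dPi i j.
  by rewrite mul0mx add0r mulmxA.
- rewrite KE big1 // => j _.
  have -> : (r == hi j) && (c == lo j) = false.
    by apply/negP => /andP[/eqP er /eqP ec]; rewrite er ec hiE ltnn in cr.
  have -> : (r == lo j) && (c == hi j) = false.
    by apply/negP => /andP[/eqP er /eqP ec]; move: cr; rewrite er ec hiE /=; lia.
  by rewrite subr0 mulr0.
- rewrite KE (bigD1 j) //= !eqxx big1 ?addr0 => [|k kj].
    rewrite (_ : (hi j == lo j) && (lo j == hi j) = false) ?subr0 ?mulr1 //.
    by apply/negP; rewrite [lo j == _]eq_sym hi_eq_lo; lia.
  have -> : (hi j == hi k) && (lo j == lo k) = false.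
    apply/negP => /andP[_ /eqP/(congr1 val) /= jk].
    by case/eqP: kj; apply: val_inj.
  have -> : (hi j == lo k) && (lo j == hi k) = false.
    by apply/negP; rewrite [lo j == _]eq_sym !hi_eq_lo; lia.
  by rewrite subr0 mulr0.
Qed.

Section Crossing.
Variables (Gamma : R -> G) (kappa : 'I_n -> R -> R) (a b ts : R).
Hypothesis Gamma_convex : locally_convex_with Pi 0 1 Gamma kappa.
Hypothesis ab01 : `[a, b] `<=` (`]0, 1[ : set R).
Hypothesis ats : a <= ts.
Hypothesis tsb : ts <= b.
Hypothesis Gamma_chart : forall t : R, t \in `[a, b] -> chart_domain (Gamma t).
Hypothesis Gamma_ts : Q (Gamma ts) *m V = 1%:M.

Let QG t := Q (Gamma t).

Let QG_ac i j : abs_cont_bounded a b (fun t => QG t i j).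
Proof.
have [_ Gac _ _] := Gamma_convex.
apply: (function_ring_mulmx (abs_cont_bounded_cst a b) (@abs_cont_bounded_add R a b)
  (@abs_cont_bounded_mul R a b)) => [k l|k l]; first exact: abs_cont_bounded_cst.
split; last by exists 1 => t _ _; apply: SO_entry_le1.
have ab : a <= b by apply: le_trans tsb.
have /ab01 /= : `[a, b]%classic a by rewrite /= in_itv /= lexx.
have /ab01 /= : `[a, b]%classic b by rewrite /= in_itv /= lexx ab.
rewrite !in_itv /= => /andP[_ b1] /andP[a0 _].
by apply: absolutely_continuous_sub (Gac k l); apply: ltW.
Qed.

Let QG_chart (t : R) : t \in `[a, b] -> \forall x \near t, lu_chart (QG x *m V).
Proof.
move=> tab; have nC : nbhs (Gamma t) chart_domain.
  by apply: open_nbhs_nbhs; split; [exact: chart_domain_open | exact: Gamma_chart].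
have H : nbhs t (Gamma @^-1` chart_domain).
  exact: (locally_convex_continuous Gamma_convex (ab01 tab) nC).
by apply: filterS H => x; exact.
Qed.

Let QG_derive : {ae mu, forall t, t \in `[a, b] -> exists K : 'M[R]_n.+1,
  [/\ forall i j, is_derive t (1 : R) (fun x => QG x i j) ((QG t *m K) i j),
      forall r c : 'I_n.+1, (c.+1 < r)%N -> K r c = 0 &
      forall j, 0 < K (hi j) (lo j)]}.
Proof.
have [_ _ k0 aeG] := Gamma_convex.
apply: ae_imply aeG => t + tab.
have t01 : t \in `[0, 1] by apply: subset_itv_oo_cc; apply: ab01.
move=> /(_ t01)[dG logd]; apply: locally_convex_derivative dG logd => j.
exact: k0.
Qed.

Let q (J : {set 'I_n.+1}) (t : R) := chart_coord (Gamma t) J.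

Let q_ac J : absolutely_continuous a b (q J).
Proof.
by have [] := coord_absolutely_continuous sg QG_ac QG_chart J.
Qed.

Let q_derive := coord_is_derive sg V_upper V_unidiag (fun t _ => Q_unit (Gamma t))
  QG_chart QG_derive.

Let q_ts J : q J ts = (J == flag_rows sg #|J|)%:R.
Proof. by rewrite /q /chart_coord /chart_lower Gamma_ts lu_upper_id mulmx1 coord1. Qed.

Let itv_sub (c d : R) : a <= c -> d <= b -> forall t : R, t \in `[c, d] -> t \in `[a, b].
Proof.
move=> ac db t; rewrite !in_itv /= => /andP[ct td].
by rewrite (le_trans ac ct) (le_trans td db).
Qed.

Let q_top (t : R) (J : {set 'I_n.+1}) : t \in `[a, b] -> J = flag_rows sg #|J| -> q J t = 1.
Proof.
move=> tab eJ; have [Ll L1] := chart_lowerP (Gamma_chart tab).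
rewrite /q /chart_coord eJ coord_flag_rows //.
by rewrite -[X in (_ <= X)%N]card_ord max_card.
Qed.

Let q_gale (t : R) (J : {set 'I_n.+1}) : t \in `[a, b] ->
  ~ gale J (flag_rows sg #|J|) -> q J t = 0.
Proof. by move=> tab; apply: chart_coord_gale; apply: Gamma_chart. Qed.

Lemma crossing_future (t : R) : ts < t -> t <= b -> chart_future (Gamma t).
Proof.
move=> tst tb; split.
  by apply: Gamma_chart; rewrite in_itv /= tb (le_trans ats (ltW tst)).
move=> J gJ; apply: (@flow_forward_positive R n ts b (flag_rows sg) q) => //.
- by move=> K; apply: absolutely_continuous_sub (lexx _) (q_ac K).
- by move=> u K uab eK; rewrite (q_top (itv_sub ats (lexx _) uab) eK) ltr01.
- by move=> u K uab; apply: q_gale; apply: (itv_sub ats (lexx _)).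
- by move=> K; rewrite q_ts.
apply: ae_imply q_derive => u Hu utb; apply: Hu; exact: (itv_sub ats (lexx _)).
Qed.

Lemma crossing_past (t : R) (J : {set 'I_n.+1}) : a <= t -> t < ts ->
  gale J (flag_rows sg #|J|) ->
  0 < (-1) ^+ (weight J + weight (flag_rows sg #|J|)) * chart_coord (Gamma t) J.
Proof.
move=> at_ tts gJ.
pose sgn (K : {set 'I_n.+1}) : R := (-1) ^+ (weight K + weight (flag_rows sg #|K|)).
pose q' K u := sgn K * q K u.
apply: (@flow_backward_positive R n a ts (flag_rows sg) q') => //.
- move=> K; have [] := abs_cont_bounded_mul (abs_cont_bounded_cst a ts (sgn K))
    (_ : abs_cont_bounded a ts (q K)) => //.
  have [qac [B qB]] := coord_absolutely_continuous sg QG_ac QG_chart K.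
  split; first exact: absolutely_continuous_sub qac.
  by exists B => u au uts; apply: qB => //; apply: le_trans tsb.
- move=> u K uab eK; rewrite /q' (q_top (itv_sub (lexx _) tsb uab) eK) mulr1.
  by rewrite /sgn -eK addnn -mul2n exprM sqrrN !expr1n ltr01.
- by move=> u K uab nK; rewrite /q' q_gale ?mulr0 //; apply: (itv_sub (lexx _) tsb).
- move=> K; rewrite /q' q_ts; case: eqVneq => [eK|_]; last by rewrite mulr0.
  by rewrite /sgn -eK addnn -mul2n exprM sqrrN expr1n mulr1.
apply: ae_imply q_derive => u Hu uats.
have [beta [b0 dq]] := Hu (itv_sub (lexx _) tsb uats).
exists beta; split=> // K.
apply: is_derive_eq (is_deriveZ (sgn K) (dq K)) _.
rewrite -sumrN scaler_sumr; apply: eq_bigr => j /andP[lK hK].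
rewrite /q' /sgn card_raise // weight_raise // addSn exprS.
rewrite /q /chart_coord /lu_lower -/(chart_lower (Gamma u)).
rewrite [LHS]/(_ *: _) /=; ring.
Qed.

End Crossing.

End CurveChart.

Lemma lu_chart_id (R : realType) n : lu_chart (1%:M : 'M[R]_n.+1).
Proof.
move=> c; rewrite lead_id det1 lu_upper_id mxE eqxx ltr01; split=> //.
by rewrite invf_lt1 // ltr1n.
Qed.

Theorem lemma3p1 (R : realType) (n : nat) (hn : (2 <= n)%N)
    (Spin : topologicalGroupType) (Pi : Spin -> 'M[R]_n.+1)
    (hPi : universal_cover Pi)
    (c : regularity) (z0 z1 : Spin) (Gamma : R -> Spin)
    (hGamma : curve_space Pi c z0 z1 Gamma)
    (ts : R) (hts : sing Pi Gamma ts) :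
  exists U : set Spin,
    [/\ open U, U (Gamma ts) &
      exists eps : R,
        [/\ 0 < eps,
            `[ts - eps, ts + eps] `<=` (`]0, 1[ : set R),
            `[ts - eps, ts + eps] `&` sing Pi Gamma = [set ts],
            Gamma @` `[ts - eps, ts + eps] `<=` U &
            exists Um Up : set Spin,
              [/\ components (U `\` Sing Pi) Um /\ open Um,
                  components (U `\` Sing Pi) Up /\ open Up,
                  Um <> Up,
                  Gamma @` `[ts - eps, ts[ `<=` Um &
                  Gamma @` `]ts, ts + eps] `<=` Up]]].
Proof.
have [_ cov _] := hPi; have [Pi_cont Pi_range _] := cov.
have Pi_SO z : SO (Pi z) by rewrite -Pi_range; exists z.
have [[kappa convex] _ _ _] := hGamma.
have [[ts01 sing_ts] nts] := hts.
have tsI : ts \in `]0, 1[.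
  have [ts0 ts1] : ts != 0 /\ ts != 1.
    by split; apply/eqP => e; apply: nts; [left | right].
  move: ts01; rewrite /= !in_itv /= => /andP[t0 t1].
  by rewrite !lt_neqAle t0 t1 eq_sym ts0 ts1.
have [U [V [s [Uu U0 Vu V1 UVs]]]] := bruhat (SO_unit (Pi_SO (Gamma ts))).
have normal_ts : invmx (perm_mx s) *m U *m Pi (Gamma ts) *m V = 1%:M.
  by rewrite -2!mulmxA [U *m _]mulmxA UVs mulVmx // unitmx_perm.
pose N := chart_domain Pi U V s.
have oN : open N by apply: chart_domain_open.
have Nts : N (Gamma ts) by rewrite /N /chart_domain /= normal_ts; apply: lu_chart_id.
have NSing : N `\` Sing Pi = N `&` Bru_eta Pi by rewrite /Sing setDE setCK.
have [eps [e0 eI eN]] : exists eps, [/\ 0 < eps,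
    `[ts - eps, ts + eps] `<=` (`]0, 1[ : set R) &
    forall t : R, t \in `[ts - eps, ts + eps] -> N (Gamma t)].
  have n01 : nbhs ts `]0, 1[%classic.
    by apply: open_nbhs_nbhs; split; [exact: interval_open|].
  have nN : nbhs ts (Gamma @^-1` N).
    have nNG : nbhs (Gamma ts) N by apply: open_nbhs_nbhs.
    exact: (locally_convex_continuous convex tsI nNG).
  have : nbhs ts (`]0, 1[%classic `&` Gamma @^-1` N) by apply: filterI.
  move=> /nbhs_ballP[r /= r0 rH].
  have sub (t : R) : t \in `[ts - r / 2, ts + r / 2] -> ball ts r t.
    by rewrite in_itv /= /ball /= ltr_norml => /andP[? ?]; apply/andP; split; lra.
  exists (r / 2); split; first by rewrite divr_gt0.
    by move=> t /sub/rH[].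
  by move=> t /sub/rH[].
set a := ts - eps in eI eN; set b := ts + eps in eI eN.
have ats : a < ts by rewrite /a; lra.
have tsb : ts < b by rewrite /b; lra.
have tI : `]ts, b] `<=` (`[a, b] : set R).
  by move=> t /=; rewrite !in_itv /= => /andP[t1 ->]; rewrite (ltW (lt_trans ats t1)).
have tI' : `[a, ts[ `<=` (`[a, b] : set R).
  by move=> t /=; rewrite !in_itv /= => /andP[-> t1]; rewrite (ltW (lt_trans t1 tsb)).
pose I k := flag_rows (@eta n * s)%g k.
have future t : t \in `]ts, b] -> chart_future Pi U V s (Gamma t).
  rewrite in_itv /= => /andP[t1 t2].
  exact: (crossing_future Pi_cont Pi_SO U0 Vu V1 convex eI (ltW ats) (ltW tsb) eN normal_ts).
have past t J : t \in `[a, ts[ -> gale J (I #|J|) ->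
    0 < (-1) ^+ (weight J + weight (I #|J|)) * chart_coord Pi U V s (Gamma t) J.
  rewrite in_itv /= => /andP[t1 t2].
  exact: (crossing_past Pi_cont Pi_SO U0 Vu V1 convex eI (ltW ats) (ltW tsb) eN normal_ts).
have gale_I k : (k <= n.+1)%N -> gale (init n.+1 k) (I #|init n.+1 k|).
  move=> kn; have := gale_init (I k).
  by rewrite /I card_flag_rows // card_init.
have Bru_future t : t \in `]ts, b] -> Bru_eta Pi (Gamma t).
  move=> tI0; apply/(Bru_etaP Uu U0 Vu V1 (eN t (tI t tI0))) => k kn.
  by rewrite gt_eqF //; apply: (future t tI0).2; apply: gale_I.
have Bru_past t : t \in `[a, ts[ -> Bru_eta Pi (Gamma t).
  move=> tI0; apply/(Bru_etaP Uu U0 Vu V1 (eN t (tI' t tI0))) => k kn.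
  apply: contraTneq (past t _ tI0 (gale_I k kn)) => ->.
  by rewrite mulr0 ltxx.
have cG : {within `[a, b], continuous Gamma}.
  have [cG _ _ _] := convex; apply: continuous_subspaceW cG => t tab.
  exact: subset_itv_oo_cc (eI t tab).
have lc := covering_locally_connected cov.
have comp_open z : open (connected_component (N `\` Sing Pi) z).
  apply: connected_component_open => //; rewrite NSing.
  exact: chart_regular_open.
have reg_future t : t \in `]ts, b] -> (N `\` Sing Pi) (Gamma t).
  by move=> tI0; rewrite NSing; split; [exact/eN/tI | exact: Bru_future].
have reg_past t : t \in `[a, ts[ -> (N `\` Sing Pi) (Gamma t).
  by move=> tI0; rewrite NSing; split; [exact/eN/tI' | exact: Bru_past].
have bI : b \in `]ts, b] by rewrite in_itv /= tsb lexx.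
have aI : a \in `[a, ts[ by rewrite in_itv /= ats lexx.
have image_component (D : interval R) t : [set` D] `<=` (`[a, b] : set R) ->
    (forall u, u \in D -> (N `\` Sing Pi) (Gamma u)) -> t \in D ->
    Gamma @` [set` D] `<=` connected_component (N `\` Sing Pi) (Gamma t).
  move=> Dab Dreg tD; apply: connected_component_max.
  - by exists t.
  - by move=> _ [u uD <-]; apply: Dreg.
  apply: connected_continuous_connected; last exact: continuous_subspaceW cG.
  exact/connected_intervalP/interval_is_interval.
exists N; split; [exact: oN | exact: Nts | exists eps; split].
- exact: e0.
- exact: eI.
- apply/seteqP; split=> [t [tab [[t01 St] _]]|_ ->]; last first.
    by split; [rewrite /= in_itv /= -/a -/b !ltW | exact: hts].
  move: tab; rewrite /= in_itv /= -/a -/b => /andP[at_ tb].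
  have [tts|tst|//] := ltgtP t ts.
    by case: St; apply: Bru_past; rewrite in_itv /= at_.
  by case: St; apply: Bru_future; rewrite in_itv /= tst.
- by move=> _ [t tab <-]; apply: eN.
exists (connected_component (N `\` Sing Pi) (Gamma a)),
  (connected_component (N `\` Sing Pi) (Gamma b)); split.
- by split; [exists (Gamma a); first exact: reg_past | exact: comp_open].
- by split; [exists (Gamma b); first exact: reg_future | exact: comp_open].
- move=> same.
  have : connected_component (N `\` Sing Pi) (Gamma b) (Gamma a).
    by rewrite -same; apply: connected_component_refl; apply: reg_past.
  rewrite NSing => /(chart_future_component Pi_cont Uu U0 Vu V1) H.
  have {H}[_ Ha] : chart_future Pi U V s (Gamma a).
    apply: H; last exact: future.
    by rewrite inE -NSing; apply: reg_future.
  (* Some leading minor vanishes at the singular point, so [init k] differs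
     from [I k]; it can then be raised inside the Gale order, which changes
     the parity of the weight, hence the sign in the past. *)
  have [k kn kI] : exists2 k, (k <= n.+1)%N & init n.+1 k != I k.
    apply: contrapT => nk; apply: sing_ts.
    apply/(Bru_etaP Uu U0 Vu V1 Nts) => k kn.
    rewrite /chart_coord /chart_lower normal_ts lu_upper_id mulmx1 coord1.
    rewrite card_init // -/(I k); have [_|ne] := eqVneq (init n.+1 k) (I k).
      exact: oner_neq0.
    by case: nk; exists k.
  have g1 := gale_I k kn; rewrite card_init // in g1.
  have [j [lj hj g2]] := gale_step g1 kI.
  have cr : #|raise (init n.+1 k) j| = k by rewrite card_raise // card_init.
  have := past a (init n.+1 k) aI; rewrite card_init // => /(_ g1) p1.
  have := past a _ aI; rewrite -[in X in gale _ (I X)]cr in g2 => /(_ _ g2).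
  rewrite cr weight_raise // addSn exprS => p2.
  have := Ha (init n.+1 k); rewrite card_init // => /(_ g1) q1.
  have := Ha _; rewrite -/(I _) => /(_ _ g2) q2.
  move: p1 p2; rewrite -signr_odd; case: (odd _); rewrite ?expr1 ?expr0; nra.
- by apply: image_component.
- by apply: image_component.
Qed.
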